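(* (1) $\Upsilon_{\mid\mathcal{H}_{\mathcal{SPP}}}:\mathcal{H}_{\mathcal{SPP}}\longrightarrow\mathcal{H}_{\mathcal{HOF}}$ is an isomorphism of graded Hopf algebras, and respects the pairings (i.e. $\langle\Upsilon(x),\Upsilon(y)\rangle=\langle x,y\rangle$ for all $x,y\in\mathcal{H}_{\mathcal{SPP}}$). (2) The restriction $\langle-,-\rangle_{\mid\mathcal{H}_{\mathcal{HOF}}}$ is nondegenerate.
   Context: $\mathbb{K}$ is a commutative field. Special posets. A double poset is a finite set with two partial orders $(P,\leq_1,\leq_2)$, considered up to isomorphism (bijections preserving and reflecting both orders). Subsets are double posets by restriction. It is special if $\leq_2$ is total. A special poset is an ordered forest if $(P,\leq_1)$ is a rooted forest, roots being minimal (for each $x$, $\{y: y\leq_1 x\}$ is totally ordered by $\leq_1$); it is heap-ordered if $x\leq_1 y$ implies $x\leq_2 y$. $\mathcal{HOF}$ is the set of heap-ordered ordered forests. A plane poset is a double poset $(P,\leq_h,\leq_r)$ such that two distinct elements are comparable for $\leq_h$ if and only if they are not comparable for $\leq_r$; then $x\leq y$ iff ($x\leq_h y$ or $x\leq_r y$) is a total order and $(P,\leq_h,\leq)$ is called a special plane poset. Hopf algebra. $\mathcal{H}_{\mathcal{SP}}$ is the $\mathbb{K}$-vector space with basis the special posets, graded by cardinality. The product $PQ$ is the disjoint union of $P$ and $Q$, with $P,Q$ as double subposets, $x\leq_2 y$ for all $x\in P,y\in Q$, and no element of $P$ being $\leq_1$-comparable with an element of $Q$; the unit is the empty poset. The coproduct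 is $\Delta(P)=\sum_I (P\setminus I)\otimes I$, over subsets $I\subseteq P$ such that $x\in I$, $x\leq_1 y$ imply $y\in I$. $\mathcal{H}_{\mathcal{SPP}}$ and $\mathcal{H}_{\mathcal{HOF}}$ are the Hopf subalgebras spanned by special plane posets and by heap-ordered forests. Pairing. $\langle P,Q\rangle$ is the number of bijections $\sigma:P\to Q$ such that, for all $i,j\in P$, ($i\leq_1 j$ in $P$) implies ($\sigma(i)\leq_2\sigma(j)$ in $Q$), and ($\sigma(i)\leq_1\sigma(j)$ in $Q$) implies ($i\leq_2 j$ in $P$); extended bilinearly. The map $\Upsilon:\mathcal{H}_{\mathcal{SP}}\to\mathcal{H}_{\mathcal{HOF}}$ is the linear map defined as follows. For a special poset $Q$ let $R_Q$ be the set of edges of the Hasse graph of $(Q,\leq_1)$: pairs $(a,b)$ with $a\neq b$ and $\{c: a\leq_1 c\leq_1 b\}=\{a,b\}$. For an acyclic relation $R$ on the set $Q$, let $Q[R]$ be the special poset with the same set and same $\leq_2$ as $Q$, whose first order is the reflexive-transitive closure of $R$. For a special poset $P$, $\Upsilon(P)$ is the linear combination of heap-ordered forests obtained from $P$ by applying repeatedly, to terms $Q$ of the current linear combination, the following replacements until only heap-ordered forests remain (the result does not depend on the choices): (T1) if $i<_2 j$ and $(j,i)\in R_Q$: $Q\mapsto Q[R_Q\setminus\{(j,i)\}]-Q[(R_Q\setminus\{(j,i)\})\cup\{(i,j)\}]$; (T2) if $i<_2 j<_2 k$ and $(i,k),(j,k)\in R_Q$: $Q\mapsto Q[R_Q\setminus\{(j,k)\}]-Q[(R_Q\setminus\{(j,k)\})\cup\{(i,j)\}]+Q[(R_Q\setminus\{(j,k),(i,k)\})\cup\{(i,j),(j,k)\}]$.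 Equivalently, $\Upsilon=(\Theta_{\mid\mathcal{H}_{\mathcal{HOF}}})^{-1}\circ\Theta$. Here $\Theta$ is the linear map from $\mathcal{H}_{\mathcal{SP}}$ to the vector space $\mathbf{FQSym}$ with basis all permutations given by $\Theta(P)=\sum\sigma$ over the $\sigma\in\mathfrak{S}_n$ such that $i<_1 j$ in $P$ implies $\sigma^{-1}(i)<\sigma^{-1}(j)$ (identifying $(P,\leq_2)$ with $\{1,\ldots,n\}$), and its restriction to $\mathcal{H}_{\mathcal{HOF}}$ is bijective. *)

(* Defs.v *)
From HB Require Import structures.
From mathcomp Require Import all_boot all_order all_algebra finmap zify.
From mathcomp Require Import monalg.

Set Implicit Arguments.
Unset Strict Implicit.
Unset Printing Implicit Defensive.

Import GRing.Theory.

Definition partial_order (T : Type) (r : rel T) : Prop :=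
  [/\ reflexive r, antisymmetric r & transitive r].

Definition porderb (T : finType) (r : rel T) : bool :=
  [&& [forall x, r x x],
      [forall x, forall y, r x y && r y x ==> (x == y)] &
      [forall x, forall y, forall z, r x y && r y z ==> r x z]].

Lemma porderP (T : finType) (r : rel T) : reflect (partial_order r) (porderb r).
Proof.
apply: (iffP and3P) => [[/forallP rr /forallP ra /forallP rt]|[rr ra rt]].
  split=> [x||]; first exact: rr.
    by move=> x y rxy; apply/eqP/(implyP (forallP (ra x) y)).
  move=> y x z rxy ryz; apply: (implyP (forallP (forallP (rt x) y) z)).
  by rewrite rxy.
split; first exact/forallP.
  by apply/forallP=> x; apply/forallP=> y; apply/implyP=> /ra ->.
apply/forallP=> x; apply/forallP=> y; apply/forallP=> z.
by apply/implyP=> /andP[rxy ryz]; apply: rt rxy ryz.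
Qed.

(** * Double posets *)

Record dposet := DPoset {
  carrier :> finType;
  le1 : rel carrier;
  le2 : rel carrier;
  le1_po : partial_order le1;
  le2_po : partial_order le2 }.

Definition special (D : dposet) : Prop := total (@le2 D).

Definition diso (D E : dposet) : Prop :=
  exists f : D -> E, [/\ bijective f,
    forall x y, le1 (f x) (f y) = le1 x y &
    forall x y, le2 (f x) (f y) = le2 x y].

(* [le1] is a rooted forest, with roots minimal *)
Definition ordered_forest (D : dposet) : bool :=
  [forall x : D, forall y : D, forall z : D,
    le1 y x && le1 z x ==> le1 y z || le1 z y].

Definition heap_ordered (D : dposet) : bool :=
  [forall x : D, forall y : D, le1 x y ==> le2 x y].

Definition is_hof (D : dposet) : bool := ordered_forest D && heap_ordered D.

Definition plane (D : dposet) : Prop :=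
  forall x y : D, x != y ->
    (le1 x y || le1 y x) = ~~ (le2 x y || le2 y x).

(* [D] is (E, <=_h, <=) for a plane poset (E, <=_h, <=_r), up to isomorphism *)
Definition special_plane (D : dposet) : Prop :=
  exists (E : dposet) (f : D -> E), [/\ plane E, bijective f,
    forall x y, le1 x y = le1 (f x) (f y) &
    forall x y, le2 x y = le1 (f x) (f y) || le2 (f x) (f y)].

Section Restriction.
Variables (D : dposet) (A : {set D}).

Let T : finType := {x : D | x \in A}.

Lemma drestr_po (r : rel D) :
  partial_order r -> partial_order (fun x y : T => r (val x) (val y)).
Proof.
case=> rr ra rt; split=> [x|x y /ra/val_inj|y x z] //=; exact: rt.
Qed.

Definition drestr : dposet :=
  DPoset (drestr_po (le1_po D)) (drestr_po (le2_po D)).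

End Restriction.

Section DisjointUnion.
Variables D E : dposet.

Definition sum_le1 (u v : D + E) : bool :=
  match u, v with
  | inl x, inl y => le1 x y
  | inr x, inr y => le1 x y
  | _, _ => false
  end.

Definition sum_le2 (u v : D + E) : bool :=
  match u, v with
  | inl x, inl y => le2 x y
  | inr x, inr y => le2 x y
  | inl _, inr _ => true
  | inr _, inl _ => false
  end.

Lemma sum_le1_po : partial_order sum_le1.
Proof.
have [[r a t] [r' a' t']] := (le1_po D, le1_po E).
split=> [[]x|[]x []y //= h|[]y []x []z] //=.
- by congr inl; apply: a.
- by congr inr; apply: a'.
- exact: t.
- exact: t'.
Qed.

Lemma sum_le2_po : partial_order sum_le2.
Proof.
have [[r a t] [r' a' t']] := (le2_po D, le2_po E).
split=> [[]x|[]x []y //= h|[]y []x []z] //=.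
- by congr inl; apply: a.
- by congr inr; apply: a'.
- exact: t.
- exact: t'.
Qed.

Definition dsum : dposet := DPoset sum_le1_po sum_le2_po.

End DisjointUnion.

(** * Isomorphism classes of special posets
    A special double poset with n elements is isomorphic to exactly one double
    poset on 'I_n whose second order is the usual one (lemmas [diso_std],
    [diso_sposet]), so a partial order on 'I_n encodes an isomorphism class. *)

Record sposet := SPoset {
  sp_size : nat;
  sp_rel : {set 'I_sp_size * 'I_sp_size};
  sp_po : porderb (fun x y => (x, y) \in sp_rel) }.

Definition sposet_sig (P : sposet) :
    {n : nat & {r : {set 'I_n * 'I_n} | porderb (fun x y => (x, y) \in r)}} :=
  existT _ (sp_size P) (exist _ (sp_rel P) (sp_po P)).
Definition sig_sposet
    (s : {n : nat & {r : {set 'I_n * 'I_n} | porderb (fun x y => (x, y) \in r)}}) :=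
  SPoset (proj2_sig (tagged s)).
Lemma sposet_sigK : cancel sposet_sig sig_sposet.
Proof. by case. Qed.

(* opaque, so that unification does not unfold these instances *)
Fact sposet_hasDecEq : hasDecEq sposet.
Proof. by case: (Choice.on (can_type sposet_sigK)). Qed.
Fact sposet_hasChoice : hasChoice sposet.
Proof. by case: (Choice.on (can_type sposet_sigK)). Qed.
HB.instance Definition _ := sposet_hasDecEq.
HB.instance Definition _ := sposet_hasChoice.

Lemma sposet_eq n (r r' : {set 'I_n * 'I_n}) p p' :
  r = r' -> @SPoset n r p = @SPoset n r' p'.
Proof. by move=> e; case: r' / e p'=> p'; rewrite (bool_irrelevance p p'). Qed.

Lemma ord_leq_po n : partial_order (fun x y : 'I_n => x <= y).
Proof.
split=> [x|x y|y x z] //; last exact: leq_trans.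
by rewrite -eqn_leq => /eqP/val_inj.
Qed.

Definition dposet_of_sposet (P : sposet) : dposet :=
  DPoset (porderP _ (sp_po P)) (@ord_leq_po (sp_size P)).
Coercion dposet_of_sposet : sposet >-> dposet.

Lemma special_sposet (P : sposet) : special P.
Proof. by move=> x y; apply: leq_total. Qed.

Section Standardization.
Variable D : dposet.

Lemma size_sort_le2 : size (sort (@le2 D) (enum D)) == #|D|.
Proof. by rewrite size_sort -cardE. Qed.

(* the elements of [D], listed in increasing order for [le2] when it is total *)
Definition le2_enum : #|D|.-tuple D := Tuple size_sort_le2.

Lemma le2_enum_inj : injective (tnth le2_enum).
Proof. by apply/tuple_uniqP; rewrite sort_uniq enum_uniq. Qed.

Lemma le2_enum_bij : bijective (tnth le2_enum).
Proof. by apply: (inj_card_bij le2_enum_inj); rewrite card_ord. Qed.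

Definition std_rel : {set 'I_#|D| * 'I_#|D|} :=
  [set p | le1 (tnth le2_enum p.1) (tnth le2_enum p.2)].

Lemma std_po : porderb (fun x y => (x, y) \in std_rel).
Proof.
have [r a t] := le1_po D; apply/porderP; split=> [x|x y|y x z]; rewrite !inE //.
  by move/a/le2_enum_inj.
exact: t.
Qed.

Definition std : sposet := SPoset std_po.

Lemma diso_std : special D -> diso D std.
Proof.
move=> tot; have [g gK Kg] := le2_enum_bij.
exists g; split; first by exists (tnth le2_enum).
  by move=> x y; rewrite /= inE /= !Kg.
have [r a t] := le2_po D.
have mono (i j : 'I_#|D|) :
    (i <= j)%N -> le2 (tnth le2_enum i) (tnth le2_enum j).
  have [x0 _] : exists x0 : D, x0 = tnth le2_enum i by exists (tnth le2_enum i).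
  move=> ij; rewrite !(tnth_nth x0).
  have lt_size (k : 'I_#|D|) : (k < size (sort (@le2 D) (enum D)))%N.
    by rewrite (eqP size_sort_le2).
  have srt : sorted (@le2 D) (sort (@le2 D) (enum D)) by exact: sort_sorted.
  have := sorted_leq_nth t r x0 srt.
  by move=> /(_ i j (lt_size i) (lt_size j) ij).
move=> x y; rewrite /= -{2}[x]Kg -{2}[y]Kg.
apply/idP/idP=> [|h]; first exact: mono.
rewrite leqNgt; apply/negP=> yx.
have /le2_enum_inj exy := a _ _ (introT andP (conj h (mono _ _ (ltnW yx)))).
by rewrite exy ltnn in yx.
Qed.

End Standardization.

Lemma diso_refl D : diso D D.
Proof. by exists id; split=> //; exists id. Qed.

Lemma diso_sym D E : diso D E -> diso E D.
Proof.
case=> f [[g fK gK] h1 h2]; exists g; split; first by exists f.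
- by move=> x y; rewrite -h1 !gK.
- by move=> x y; rewrite -h2 !gK.
Qed.

Lemma diso_trans D E F : diso D E -> diso E F -> diso D F.
Proof.
case=> f [bf h1 h2] [g [bg k1 k2]]; exists (g \o f); split=> [|x y|x y] /=.
- exact: bij_comp.
- by rewrite k1.
- by rewrite k2.
Qed.

Lemma card_ord_le n (x : 'I_n) : #|[set y : 'I_n | (y <= x)%N]| = x.+1.
Proof.
have le : (x.+1 <= n)%N by [].
have inj : injective (widen_ord le) by move=> a b /(congr1 val)/= /val_inj.
rewrite -[RHS]card_ord -(card_imset _ inj).
apply: eq_card => y; rewrite inE; apply/idP/imsetP=> [yx|[z _ ->]].
  by exists (Ordinal (yx : (y < x.+1)%N)) => //; apply: val_inj.
by rewrite /= -ltnS.
Qed.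

Lemma diso_sposet (P Q : sposet) : diso P Q -> P = Q.
Proof.
case: P Q => [n r p] [m s q] [f [bf h1 h2]].
have enm : n = m by have := bij_eq_card bf; rewrite !card_ord.
move: s q f bf h1 h2; rewrite -enm {m enm} => s q f bf h1 h2.
have idf (x : 'I_n) : f x = x.
  apply/val_inj/succn_inj.
  rewrite -!card_ord_le -[RHS](card_imset _ (bij_inj bf)).
  apply: eq_card => y; rewrite inE; have [g fK gK] := bf.
  apply/idP/imsetP => [|[z]]; rewrite ?inE => le.
    by exists (g y); rewrite ?inE ?gK //; have := h2 (g y) x; rewrite /= gK le.
  by move=> ->; have := h2 z x; rewrite /= le.
by apply: sposet_eq; apply/setP=> -[x y]; have := h1 x y; rewrite /= !idf.
Qed.

Lemma std_sposet (P : sposet) : std P = P.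
Proof. exact/diso_sposet/diso_sym/diso_std/special_sposet. Qed.

Lemma diso_std_eq D E : special D -> diso D E -> std D = std E.
Proof.
move=> sD DE; apply: diso_sposet.
have sE : special E.
  have [f [[g fK gK] h1 h2]] := DE.
  by move=> x y; rewrite -[x]gK -[y]gK !h2; apply: sD.
apply: diso_trans (diso_trans DE (diso_std sE)).
exact/diso_sym/diso_std.
Qed.

(** * The monoid of special posets *)

Lemma special_dsum D E : special D -> special E -> special (dsum D E).
Proof. by move=> sD sE [x|x] [y|y] //=. Qed.

Lemma diso_dsum D D' E E' :
  diso D D' -> diso E E' -> diso (dsum D E) (dsum D' E').
Proof.
case=> f [[f' fK f'K] f1 f2] [g [[g' gK g'K] g1 g2]].
exists (fun u => match u with inl x => inl (f x) | inr y => inr (g y) end).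
split=> [|[x|x] [y|y]|[x|x] [y|y]] //=.
by exists (fun u => match u with inl x => inl (f' x) | inr y => inr (g' y) end);
  case=> x; rewrite ?fK ?f'K ?gK ?g'K.
Qed.

Lemma diso_dsumA D E F : diso (dsum D (dsum E F)) (dsum (dsum D E) F).
Proof.
pose f (u : D + (E + F)) : (D + E) + F := match u with
  | inl x => inl (inl x) | inr (inl x) => inl (inr x) | inr (inr x) => inr x end.
pose g (u : (D + E) + F) : D + (E + F) := match u with
  | inl (inl x) => inl x | inl (inr x) => inr (inl x) | inr x => inr (inr x) end.
exists f; split.
- by exists g; [case=> [|[]]|case=> [[]|]].
- by move=> [x|[x|x]] [y|[y|y]].
- by move=> [x|[x|x]] [y|[y|y]].
Qed.

Lemma sp0_po : porderb (fun x y : 'I_0 => (x, y) \in set0).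
Proof. by apply/porderP; split; case. Qed.
Definition sp0 : sposet := SPoset sp0_po.

Definition sp_mul (P Q : sposet) : sposet := std (dsum P Q).

Lemma sp_mulA : associative sp_mul.
Proof.
move=> P Q R.
have sp := special_sposet; have sd := special_dsum.
have [sQR sPQ] := (sd _ _ (sp Q) (sp R), sd _ _ (sp P) (sp Q)).
transitivity (std (dsum P (dsum Q R))).
  apply/esym/diso_std_eq; first exact: sd (sp P) sQR.
  exact: diso_dsum (diso_refl _) (diso_std sQR).
transitivity (std (dsum (dsum P Q) R)).
  by apply: diso_std_eq; [exact: sd (sp P) sQR | exact: diso_dsumA].
apply: diso_std_eq; first exact: sd sPQ (sp R).
exact: diso_dsum (diso_std sPQ) (diso_refl _).
Qed.

Lemma sp_mul0 : left_id sp0 sp_mul.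
Proof.
move=> P; rewrite -[RHS]std_sposet; apply/diso_std_eq.
  exact/special_dsum/special_sposet/special_sposet.
exists (fun u : 'I_0 + 'I_(sp_size P) =>
  match u with inl x => False_rect _ (notF (ltn_ord x)) | inr y => y end).
split; last by move=> [[]//|x] [[]//|y].
  by exists inr => [[[]|]|].
by move=> [[]//|x] [[]//|y].
Qed.

Lemma sp_mulr0 : right_id sp0 sp_mul.
Proof.
move=> P; rewrite -[RHS]std_sposet; apply/diso_std_eq.
  exact/special_dsum/special_sposet/special_sposet.
exists (fun u : 'I_(sp_size P) + 'I_0 =>
  match u with inr x => False_rect _ (notF (ltn_ord x)) | inl y => y end).
split; last by move=> [x|[]//] [y|[]//].
  by exists inl => [[|[]]|].
by move=> [x|[]//] [y|[]//].
Qed.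

Lemma sp_size_mul (P Q : sposet) : sp_size (sp_mul P Q) = (sp_size P + sp_size Q)%N.
Proof. by rewrite /= card_sum !card_ord. Qed.

Lemma sp_size0 (P : sposet) : sp_size P = 0%N -> P = sp0.
Proof.
case: P => n r p /= n0; case: _ / (esym n0) r p => r p.
by apply: sposet_eq; apply/setP=> -[[]].
Qed.

Lemma sp_mul_eq0 P Q : sp_mul P Q = sp0 -> P = sp0 /\ Q = sp0.
Proof.
move=> /(congr1 sp_size); rewrite sp_size_mul => /eqP.
by rewrite addn_eq0 => /andP[/eqP/sp_size0 -> /eqP/sp_size0 ->].
Qed.

HB.instance Definition _ := Choice_isMonomialDef.Build sposet
  sp_mulA sp_mul0 sp_mulr0 sp_mul_eq0.

(** * The Hopf algebra of special posets *)

Local Open Scope ring_scope.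

(* The algebra structure of [HSP K] is that of the monoid algebra of [sposet];
   [HSP2 K] stands for the tensor square of [HSP K]. *)
Notation HSP K := {malg K[sposet]}.
Notation HSP2 K := {malg K[(sposet * sposet)%type]}.

Section Linear.
Variable K : fieldType.

Definition lin_ext (T : choiceType) (V : lmodType K) (f : T -> V)
    (x : {malg K[T]}) : V :=
  \sum_(t <- msupp x) x@_t *: f t.

Definition tensor (x y : HSP K) : HSP2 K :=
  \sum_(P <- msupp x) \sum_(Q <- msupp y) << x@_P * y@_Q *g (P, Q) >>.

Definition tensor_map (f g : HSP K -> HSP K) : HSP2 K -> HSP2 K :=
  lin_ext (fun p => tensor (f << p.1 >>) (g << p.2 >>)).

Definition spanned_by (A : sposet -> Prop) (x : HSP K) : Prop :=
  forall P, P \in msupp x -> A P.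

Definition homogeneous (n : nat) : HSP K -> Prop :=
  spanned_by (fun P => sp_size P = n).

End Linear.

Definition upper_set (D : dposet) (I : {set D}) : bool :=
  [forall x : D, forall y : D, (x \in I) && le1 x y ==> (y \in I)].

Lemma lin_extU (K : fieldType) (T : choiceType) (V : lmodType K) (f : T -> V) t :
  lin_ext f << t >> = f t.
Proof.
have e : msupp (<< t >> : {malg K[T]}) = [fset t]%fset.
  by rewrite msuppU oner_eq0.
by rewrite /lin_ext e big_seq_fset1 mcoeffUU scale1r.
Qed.

Section Hopf.
Variable K : fieldType.

Definition counit (x : HSP K) : K := x@_sp0.

Definition coproduct : HSP K -> HSP2 K :=
  lin_ext (fun P : sposet =>
    \sum_(I : {set (P : dposet)} | upper_set I)
      << (std (drestr (~: I)), std (drestr I)) >>).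

(* As [HSP K] is graded and connected, the antipode S is determined by
   \sum_I S(P \ I) I = 0 for P nonempty, whose term with I empty is S(P).
   The first argument only bounds the recursion depth. *)
Fixpoint antipode_rec (n : nat) (P : sposet) : HSP K :=
  if P == sp0 then 1 else
  if n is n'.+1 then
    - \sum_(I : {set (P : dposet)} | upper_set I && (I != set0))
        antipode_rec n' (std (drestr (~: I))) * << std (drestr I) >>
  else 0.

Definition antipode : HSP K -> HSP K :=
  lin_ext (fun P => antipode_rec (sp_size P) P).

Lemma antipode_rec_fuel n m P : (sp_size P <= n)%N -> (sp_size P <= m)%N ->
  antipode_rec n P = antipode_rec m P.
Proof.
elim: n m P => [|n IH] [|m] P //=; try by rewrite leqn0 => /eqP/sp_size0 -> //; rewrite eqxx.
  by move=> _; rewrite leqn0 => /eqP/sp_size0 ->; rewrite eqxx.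
move=> Pn Pm; case: eqP => // _; congr (- _); apply: eq_bigr => I /andP[_ nI].
have lt : (#|~: I| < sp_size P)%N.
  by rewrite -[ltnRHS]card_ord -(cardsC I) -[ltnLHS]add0n ltn_add2r card_gt0.
have szI : sp_size (std (@drestr P (~: I))) = #|~: I| by rewrite /= card_sig.
by congr (_ * _); apply: IH; rewrite szI -ltnS; apply: leq_trans lt _.
Qed.

Lemma antipodeE P : P != sp0 ->
  \sum_(I : {set (P : dposet)} | upper_set I)
    antipode << std (drestr (~: I)) >> * << std (drestr I) >> = 0.
Proof.
move=> nP; rewrite (bigD1 set0) /=; last first.
  by apply/forallP=> x; apply/forallP=> y; rewrite inE.
have -> : std (drestr (~: (set0 : {set (P : dposet)}))) = P.
  rewrite -[RHS]std_sposet; apply: diso_std_eq.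
    by move=> x y; apply: special_sposet.
  exists val; split=> //; apply: inj_card_bij; first exact: val_inj.
  by rewrite card_sig setC0 cardsT.
have -> : std (drestr (set0 : {set (P : dposet)})) = sp0.
  by apply: sp_size0; rewrite /= card_sig cards0.
rewrite mulr1 /antipode lin_extU.
case: P nP => [[|n] r p] nP; first by rewrite (sp_size0 (erefl : sp_size (SPoset p) = 0%N)) eqxx in nP.
rewrite [antipode_rec _ _]/= (negbTE nP) addrC; apply/eqP; rewrite subr_eq0; apply/eqP.
apply: eq_bigr => I /andP[_ nI]; rewrite lin_extU; congr (_ * _).
apply: antipode_rec_fuel => //.
rewrite /= card_sig -ltnS -[ltnRHS]card_ord -(cardsC I) -[ltnLHS]add0n ltn_add2r.
by rewrite card_gt0.
Qed.

End Hopf.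

Definition pictures (D E : dposet) : {set {ffun D -> E}} :=
  [set s : {ffun D -> E} | [&& injectiveb s, [forall y, exists x, s x == y],
    [forall i, forall j, le1 i j ==> le2 (s i) (s j)] &
    [forall i, forall j, le1 (s i) (s j) ==> le2 i j]]].

Definition pairing (K : fieldType) (x y : HSP K) : K :=
  \sum_(P <- msupp x) \sum_(Q <- msupp y) x@_P * y@_Q * #|pictures P Q|%:R.

Definition HSPP (K : fieldType) : HSP K -> Prop :=
  spanned_by (fun P => special_plane P).

Definition HHOF (K : fieldType) : HSP K -> Prop :=
  spanned_by (fun P => is_hof P).

(* [f] restricts to an isomorphism from [A] to [B], for Hopf subalgebras [A]
   and [B] of [HSP K], graded by cardinality. *)
Record graded_hopf_iso (K : fieldType) (A B : HSP K -> Prop)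
    (f : HSP K -> HSP K) : Prop := GradedHopfIso {
  iso_linear : forall (a : K) x y, A x -> A y -> f (a *: x + y) = a *: f x + f y;
  iso_image : forall x, A x -> B (f x);
  iso_inj : forall x y, A x -> A y -> f x = f y -> x = y;
  iso_surj : forall y, B y -> exists2 x, A x & f x = y;
  iso_graded : forall n x, A x -> homogeneous n x -> homogeneous n (f x);
  iso_one : f 1 = 1;
  iso_mul : forall x y, A x -> A y -> f (x * y) = f x * f y;
  iso_counit : forall x, A x -> counit (f x) = counit x;
  iso_coproduct : forall x, A x ->
    coproduct (f x) = tensor_map f f (coproduct x);
  iso_antipode : forall x, A x -> f (antipode x) = antipode (f x) }.

Definition nondegenerate_on (K : fieldType) (A : HSP K -> Prop)
    (b : HSP K -> HSP K -> K) : Prop :=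
  (forall x, A x -> (forall y, A y -> b x y = 0) -> x = 0) /\
  (forall y, A y -> (forall x, A x -> b x y = 0) -> y = 0).

(** * The map Upsilon *)

Definition hasse (D : dposet) : {set D * D} :=
  [set p : D * D | (p.1 != p.2) &&
    ([set c | le1 p.1 c && le1 c p.2] == [set p.1; p.2])].

Definition sp_hasse (Q : sposet) : {set 'I_(sp_size Q) * 'I_(sp_size Q)} :=
  hasse Q.

Section Reorder.
Variable n : nat.
Implicit Types R : {set 'I_n * 'I_n}.

Definition reach R : rel 'I_n := connect (fun x y => (x, y) \in R).

Definition acyclic R : bool :=
  [forall x, forall y, reach R x y && reach R y x ==> (x == y)].

(* The discrete order is a junk value, never used in the transformations
   below: see [T1_acyclic], [T2_acyclic] and [T2_acyclic']. *)
Definition reorder_rel R : {set 'I_n * 'I_n} :=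
  [set p | if acyclic R then reach R p.1 p.2 else p.1 == p.2].

Lemma reorder_po R : porderb (fun x y => (x, y) \in reorder_rel R).
Proof.
apply/porderP; rewrite /reorder_rel; case aR: (acyclic R); split=> [x|x y|y x z].
- by rewrite inE /=; apply: connect0.
- by rewrite !inE /= => h; apply/eqP/(implyP (forallP (forallP aR x) y)).
- by rewrite !inE /=; apply: connect_trans.
- by rewrite inE /=.
- by rewrite !inE /= => /andP[/eqP].
- by rewrite !inE /= => /eqP -> /eqP ->.
Qed.

(* Q[R] for a special poset Q on 'I_n *)
Definition reorder R : sposet := SPoset (reorder_po R).

End Reorder.

Section Rewriting.
Variable K : fieldType.

(* [T_step Q r] means that (T1) or (T2) may replace [Q] with [r]. *)
Inductive T_step (Q : sposet) : HSP K -> Prop :=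
| T1 (R := sp_hasse Q) (i j : 'I_(sp_size Q)) of
    (i < j)%N & (j, i) \in R :
    T_step Q (<< reorder (R :\ (j, i)) >>
            - << reorder ((R :\ (j, i)) :|: [set (i, j)]) >>)
| T2 (R := sp_hasse Q) (i j k : 'I_(sp_size Q)) of
    (i < j)%N & (j < k)%N & (i, k) \in R & (j, k) \in R :
    T_step Q (<< reorder (R :\ (j, k)) >>
            - << reorder ((R :\ (j, k)) :|: [set (i, j)]) >>
            + << reorder ((R :\: [set (j, k); (i, k)])
                          :|: [set (i, j); (j, k)]) >>).

Inductive reduces : HSP K -> HSP K -> Prop :=
| reduces_refl x : reduces x x
| reduces_step x y (Q : sposet) r of Q \in msupp x & T_step Q r &
    reduces (x + x@_Q *: (r - << Q >>)) y : reduces x y.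

End Rewriting.

Section Termination.
Variable Q : sposet.
Let n := sp_size Q.
Let R := sp_hasse Q.
Implicit Types S : {set 'I_n * 'I_n}.

Implicit Types a b c i j k x y : 'I_n.

Lemma hasseP a b : (a, b) \in R ->
  [/\ a != b, (a, b) \in sp_rel Q & forall c, (a, c) \in sp_rel Q ->
    (c, b) \in sp_rel Q -> c = a \/ c = b].
Proof.
rewrite inE /= => /andP[nab /eqP/setP e]; split=> // [|c ac cb].
  by have := e a; rewrite !inE /= eqxx /= => /andP[].
have := e c; rewrite !inE /= ac cb /= => /esym/orP[]/eqP ->; by [left|right].
Qed.

Lemma reach_sub S : S \subset R -> forall x y, reach S x y -> (x, y) \in sp_rel Q.
Proof.
move=> sSR x y /connectP[p]; have [r a t] := porderP _ (sp_po Q).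
elim: p x => [|z p IH] x /=; first by move=> _ ->; apply: r.
case/andP=> /(subsetP sSR)/hasseP[_ xz _] pz e.
exact: t xz (IH _ pz e).
Qed.

Lemma reachU S i j x y : reach (S :|: [set (i, j)]) x y ->
  reach S x y \/ (reach S x i /\ reach S j y).
Proof.
case/connectP=> p; elim: p x => [|z p IH] x /=.
  by move=> _ ->; left; apply: connect0.
case/andP=> xz pz e; rewrite !inE in xz.
have [] := IH _ pz e; case/orP: xz => [xz|/eqP[-> ->]].
- by move=> h; left; apply: connect_trans h; apply: connect1.
- by move=> h; right; split=> //; apply: connect0.
- by case=> h1 h2; right; split=> //; apply: connect_trans h1; apply: connect1.
- by case=> h1 h2; right; split=> //; apply: connect0.
Qed.

Lemma acyclic_sub S : S \subset R -> acyclic S.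
Proof.
move=> sSR; apply/forallP=> x; apply/forallP=> y; apply/implyP=> /andP[xy yx].
have [r a t] := porderP _ (sp_po Q).
by apply/eqP/a; rewrite !(reach_sub sSR).
Qed.

Lemma acyclicU S i j : S \subset R -> ~ reach S j i ->
  acyclic (S :|: [set (i, j)]).
Proof.
move=> sSR nji; apply/forallP=> x; apply/forallP=> y.
apply/implyP=> /andP[/reachU xy /reachU yx].
have [r a t] := porderP _ (sp_po Q).
have tr := connect_trans.
case: xy yx => [xy|[xi jy]] [yx|[yi jx]].
- by apply/eqP/a; rewrite !(reach_sub sSR).
- by case: nji; apply: tr jx (tr _ _ _ _ _ xy yi).
- by case: nji; apply: tr jy (tr _ _ _ _ _ yx xi).
- by case: nji; apply: tr jy yi.
Qed.

Lemma T1_acyclic i j : (j, i) \in R ->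
  acyclic (R :\ (j, i)) /\ acyclic ((R :\ (j, i)) :|: [set (i, j)]).
Proof.
move=> Rji; have sub : R :\ (j, i) \subset R by apply: subsetDl.
split; first exact: acyclic_sub.
apply: acyclicU => // /connectP[[|c p] /=].
  by move=> _ eij; have [] := hasseP Rji; rewrite eij eqxx.
case/andP=> jc pc ei; have [_ _ cov] := hasseP Rji.
have /setD1P[njc /hasseP[nc jc' _]] := jc.
have /(reach_sub sub) ci : reach (R :\ (j, i)) c i by apply/connectP; exists p.
by case: (cov c jc' ci) => e; move: nc njc; rewrite e eqxx.
Qed.

Lemma T2_acyclic i j k : (i < j)%N -> (j < k)%N -> (i, k) \in R -> (j, k) \in R ->
  acyclic (R :\ (j, k)) /\ acyclic ((R :\ (j, k)) :|: [set (i, j)]).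
Proof.
move=> ij jk Rik Rjk; have sub : R :\ (j, k) \subset R by apply: subsetDl.
split; first exact: acyclic_sub.
apply: acyclicU => // /(reach_sub sub) ji.
have [_ ik _] := hasseP Rik; have [_ _ cov] := hasseP Rjk.
by case: (cov i ji ik) => e; move: ij jk; rewrite e ?ltnn // => /ltnW; lia.
Qed.

Lemma T2_acyclic' i j k : (i < j)%N -> (j < k)%N -> (i, k) \in R -> (j, k) \in R ->
  acyclic ((R :\: [set (j, k); (i, k)]) :|: [set (i, j); (j, k)]).
Proof.
move=> ij jk Rik Rjk.
have sub : (R :\: [set (j, k); (i, k)]) :|: [set (j, k)] \subset R.
  by rewrite subUset subsetDl sub1set.
rewrite [[set (i, j); _]]setUC setUA; apply: acyclicU => // /(reach_sub sub) ji.
have [_ ik _] := hasseP Rik; have [_ _ cov] := hasseP Rjk.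
by case: (cov i ji ik) => e; move: ij jk; rewrite e ?ltnn // => /ltnW; lia.
Qed.

End Termination.

Section Existence.
Variable K : fieldType.

Definition edge_weight n (p : 'I_n * 'I_n) : nat :=
  ((maxn p.1 p.2).+1 + (p.2 < p.1))%N.

(* decreases under (T1) and (T2) *)
Definition weight (Q : sposet) : nat :=
  (\sum_(p in sp_hasse Q) edge_weight p)%N.

Lemma weight_reorder n (R : {set 'I_n * 'I_n}) :
  (weight (reorder R) <= \sum_(p in R) edge_weight p)%N.
Proof.
suff sub : sp_hasse (reorder R) \subset R.
  by rewrite [leqRHS](big_setID (sp_hasse (reorder R))) /= (setIidPr sub) leq_addr.
apply/subsetP=> -[a b] /hasseP[nab]; rewrite !inE /=.
case aR: (acyclic R); last by rewrite (negbTE nab).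
move=> /connectP[p]; case/shortenP=> -[|c q] /=; first by move=> _ _ _ e; rewrite e eqxx in nab.
case/andP=> Rac pq /andP[/norP[nac _] _] _ e.
move/(_ c); rewrite !inE aR /= => cov.
have ac : reach R a c by apply: connect1.
have cb : reach R c b by apply/connectP; exists q.
have [ec|<- //] := cov ac cb.
by rewrite ec eqxx in nac.
Qed.

Lemma leq_sum_setU (T : finType) (A B : {set T}) (F : T -> nat) :
  (\sum_(p in A :|: B) F p <= \sum_(p in A) F p + \sum_(p in B) F p)%N.
Proof.
rewrite (big_setID A) /= setIUl setIid setDUl setDv set0U.
have -> : A :|: B :&: A = A by apply/setUidPl/subsetIr.
by rewrite leq_add2l [leqRHS](big_setID A) /= leq_addl.
Qed.

Lemma msupp_stepB (A B P : sposet) :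
  P \in msupp (<< A >> - << B >> : HSP K) -> P = A \/ P = B.
Proof.
rewrite -mcoeff_neq0 mcoeffB !mcoeffU1 => nz.
have [->|nA] := eqVneq P A; first by left.
have [->|nB] := eqVneq P B; first by right.
by rewrite !(eq_sym _ P) (negbTE nA) (negbTE nB) subr0 eqxx in nz.
Qed.

Lemma msupp_stepD (A B C P : sposet) :
  P \in msupp (<< A >> - << B >> + << C >> : HSP K) -> [\/ P = A, P = B | P = C].
Proof.
rewrite -mcoeff_neq0 mcoeffD mcoeffB !mcoeffU1 => nz.
have [->|nA] := eqVneq P A; first by constructor 1.
have [->|nB] := eqVneq P B; first by constructor 2.
have [->|nC] := eqVneq P C; first by constructor 3.
by rewrite !(eq_sym _ P) (negbTE nA) (negbTE nB) (negbTE nC) subr0 addr0 eqxx in nz.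
Qed.

Lemma T_step_weight (Q P : sposet) (r : HSP K) :
  T_step Q r -> P \in msupp r -> (weight P < weight Q)%N.
Proof.
have wU n (A : {set 'I_n * 'I_n}) p :
    (\sum_(q in A :|: [set p]) edge_weight q <=
     \sum_(q in A) edge_weight q + edge_weight p)%N.
  by rewrite (leq_trans (leq_sum_setU _ _ _)) // big_set1.
case=> [R i j ij Rji|R i j k ij jk Rik Rjk].
  have eQ : weight Q = (edge_weight (j, i) + \sum_(p in R :\ (j, i)) edge_weight p)%N.
    by rewrite /weight (big_setD1 _ Rji).
  have w := wU _ (R :\ (j, i)) (i, j).
  have [wij wji] : edge_weight (i, j) = j.+1 /\ edge_weight (j, i) = j.+2.
    by split; rewrite /edge_weight /=; lia.
  rewrite eQ wji; rewrite wij in w.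
  case/msupp_stepB=> ->; apply: (leq_ltn_trans (weight_reorder _)).
    by rewrite addSn ltnS leq_addl.
  by apply: leq_ltn_trans w _; rewrite addnC ltn_add2r.
have ejk : (i, k) \in R :\ (j, k).
  by rewrite in_setD1 Rik andbT xpair_eqE eqxx andbT; apply/eqP=> e; rewrite e ltnn in ij.
have eQ : weight Q = (edge_weight (j, k) + \sum_(p in R :\ (j, k)) edge_weight p)%N.
  by rewrite /weight (big_setD1 _ Rjk).
have eQ2 : (\sum_(p in R :\ (j, k)) edge_weight p)%N =
    (edge_weight (i, k) + \sum_(p in R :\: [set (j, k); (i, k)]) edge_weight p)%N.
  by rewrite (big_setD1 _ ejk) /= setDDl.
have w1 := wU _ (R :\ (j, k)) (i, j).
have w2 := leq_sum_setU (R :\: [set (j, k); (i, k)]) [set (i, j); (j, k)]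
  (@edge_weight _).
have w3 := wU _ [set (i, j)] (j, k); rewrite big_set1 in w3.
have [wij wik wjk] : [/\ edge_weight (i, j) = j.+1, edge_weight (i, k) = k.+1 &
    edge_weight (j, k) = k.+1] by split; rewrite /edge_weight /=; lia.
rewrite wij in w1 w3; rewrite wjk in w3.
rewrite eQ wjk; case/msupp_stepD=> ->; apply: (leq_ltn_trans (weight_reorder _)).
- by rewrite addSn ltnS leq_addl.
- by apply: leq_ltn_trans w1 _; rewrite addnC ltn_add2r ltnS.
rewrite eQ2 wik; apply: leq_ltn_trans w2 _.
rewrite addnA [ltnRHS]addnC ltn_add2l.
by apply: leq_ltn_trans w3 _; rewrite ltn_add2r ltnS.
Qed.

(* A path for [le1] refines to a path in the Hasse graph. *)
Lemma reach_hasse (Q : sposet) (x y : 'I_(sp_size Q)) :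
  (x, y) \in sp_rel Q -> reach (sp_hasse Q) x y.
Proof.
have [r a t] := porderP _ (sp_po Q).
pose I x y := [set c | ((x, c) \in sp_rel Q) && ((c, y) \in sp_rel Q)].
have [m] := ubnP #|I x y|; elim: m x y => // m IH x y lt xy.
have [->|nxy] := eqVneq x y; first exact: connect0.
have [H|nH] := boolP ((x, y) \in sp_hasse Q); first exact: connect1.
have [c /and4P[xc cy ncx ncy]] : exists c, [&& (x, c) \in sp_rel Q,
    (c, y) \in sp_rel Q, c != x & c != y].
  apply/existsP; apply: contraNT nH => /existsPn h.
  rewrite inE /= nxy /=; apply/eqP/setP=> c; rewrite !inE /=.
  apply/idP/orP=> [/andP[xc cy]|[]/eqP->].
  - by have := h c; rewrite xc cy /= -negb_or negbK => /orP.
  - by rewrite (r x).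
  - by rewrite (r y) andbT.
have sub u v (uv : (u, v) \in sp_rel Q) : (x, u) \in sp_rel Q ->
    (v, y) \in sp_rel Q -> I u v \subset I x y.
  move=> xu vy; apply/subsetP=> w; rewrite !inE => /andP[uw wv].
  by rewrite (t _ _ _ xu uw) (t _ _ _ wv vy).
have lt_of u v w : (u, v) \in sp_rel Q -> (x, u) \in sp_rel Q ->
    (v, y) \in sp_rel Q -> w \in I x y -> w \notin I u v -> (#|I u v| < m)%N.
  move=> uv xu vy wI wNI; apply: leq_trans (_ : #|I x y| <= m)%N; last by [].
  apply/proper_card/properP; split; [exact: sub|by exists w].
apply: (@connect_trans _ _ c).
  apply: (IH _ _ _ xc); apply: (lt_of _ _ y); rewrite ?inE ?(r y) ?(r x) ?xy //=.
  by apply: contra ncy => yc; apply/eqP/a; rewrite yc cy.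
apply: (IH _ _ _ cy); apply: (lt_of _ _ x); rewrite ?inE ?(r y) ?(r x) ?xy ?andbT //=.
by apply: contra ncx => cx; apply/eqP/a; rewrite xc cx.
Qed.

(* Every other special poset can be rewritten. *)
Lemma T_step_ex (Q : sposet) : ~~ is_hof Q -> {r : HSP K | T_step Q r}.
Proof.
move=> nQ; pose R := sp_hasse Q.
have [r a t] := porderP _ (sp_po Q).
have hP (x y : 'I_(sp_size Q)) : (x, y) \in R -> x != y by case/hasseP.
case: (pickP [pred p : 'I_(sp_size Q) * 'I_(sp_size Q) |
    (p.1 < p.2)%N && ((p.2, p.1) \in R)]) => [[i j] /= /andP[ij Rji]|no1].
  by eexists; apply: T1 ij Rji.
case: (pickP [pred p : 'I_(sp_size Q) * 'I_(sp_size Q) * 'I_(sp_size Q) |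
    [&& (p.1.1 < p.1.2)%N, (p.1.2 < p.2)%N, (p.1.1, p.2) \in R
      & (p.1.2, p.2) \in R]]) => [[[i j] k] /= /and4P[ij jk Rik Rjk]|no2].
  by eexists; apply: T2 ij jk Rik Rjk.
exfalso; move/negP: nQ; apply.
have lt (x y : 'I_(sp_size Q)) : (x, y) \in R -> (x < y)%N.
  move=> Rxy; have := no1 (y, x); rewrite /= Rxy andbT => /negbT.
  by rewrite -leqNgt leq_eqVlt => /orP[/eqP/val_inj e|//]; move: (hP _ _ Rxy); rewrite e eqxx.
have inj (x y z : 'I_(sp_size Q)) : (x, z) \in R -> (y, z) \in R -> x = y.
  move=> xz yz; case: (ltngtP x y) => [xy|yx|/val_inj //].
    by have := no2 (x, y, z); rewrite /= xy xz yz (lt _ _ yz).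
  by have := no2 (y, x, z); rewrite /= yx xz yz (lt _ _ xz).
have le (x y : 'I_(sp_size Q)) : (x, y) \in sp_rel Q -> (x <= y)%N.
  move/reach_hasse/connectP=> [p]; elim: p x => [|z p IH] x /=; first by move=> _ ->.
  by case/andP=> /lt xz pz e; apply: leq_trans (ltnW xz) (IH _ pz e).
apply/andP; split; last first.
  by apply/forallP=> x; apply/forallP=> y; apply/implyP; apply: le.
apply/forallP=> x; apply/forallP=> y; apply/forallP=> z; apply/implyP=> /andP[].
rewrite /= => /reach_hasse/connectP[p].
elim/last_ind: p x => [|p w IH] x; first by move=> _ /= -> ->; rewrite orbT.
rewrite rcons_path last_rcons => /andP[yp pw] -> zx.
have [p' pz ez] := connectP (reach_hasse zx).
case/lastP: p' pz ez => [|p' w'].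
  move=> _ /= <-; apply/orP; left.
  have sub x1 p1 : path (fun u v => (u, v) \in sp_hasse Q) x1 p1 ->
      (x1, last x1 p1) \in sp_rel Q.
    elim: p1 x1 => [|v p1 IHp] x1 /=; first by move=> _; apply: r.
    by case/andP=> /hasseP[_ x1v _] /IHp; apply: t.
  by rewrite -(last_rcons y p w); apply: sub; rewrite rcons_path yp.
rewrite rcons_path last_rcons => /andP[zp' pw'] e; rewrite -e in pw'.
have el := inj _ _ _ pw pw'.
apply: (IH (last y p)) => //.
rewrite el.
have sub x1 p1 : path (fun u v => (u, v) \in sp_hasse Q) x1 p1 ->
    (x1, last x1 p1) \in sp_rel Q.
  elim: p1 x1 => [|v p1 IHp] x1 /=; first by move=> _; apply: r.
  by case/andP=> /hasseP[_ x1v _] /IHp; apply: t.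
exact: sub.
Qed.

Definition bad_below (N : nat) (x : HSP K) :=
  forall P, P \in msupp x -> ~~ is_hof P -> (weight P < N)%N.

Lemma reduces_ex_aux N :
  (forall x : HSP K, bad_below N x -> {y | reduces x y & HHOF y}) ->
  forall (s : seq sposet) (x : HSP K),
    (forall P, P \in msupp x -> ~~ is_hof P ->
       (weight P < N)%N \/ weight P = N /\ P \in s) ->
  {y | reduces x y & HHOF y}.
Proof.
move=> IHN; elim=> [|Q s IHs] x hx.
  by apply: IHN => P Px nP; have [//|[]] := hx P Px nP.
have skip : (Q \notin msupp x) || is_hof Q -> {y | reduces x y & HHOF y}.
  move=> hQ; apply: IHs => P Px nP; have [|[wP]] := hx P Px nP; first by left.
  rewrite inE => /orP[/eqP e|]; last by right.
  by rewrite -e Px (negbTE nP) in hQ.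
have [/skip //|] := boolP ((Q \notin msupp x) || is_hof Q).
rewrite negb_or negbK => /andP[Qx nQ].
have leQ : (weight Q <= N)%N by case: (hx Q Qx nQ) => [/ltnW|[->]].
have [r Tr] := T_step_ex nQ.
suff [y y1 y2] : {y | reduces (x + x@_Q *: (r - << Q >>)) y & HHOF y}.
  by exists y => //; apply: reduces_step Qx Tr y1.
apply: IHs => P Px' nP.
have [rP|rP] := boolP (P \in msupp r).
  by left; apply: leq_trans (T_step_weight Tr rP) leQ.
move: Px'; rewrite -mcoeff_neq0 mcoeffD mcoeffZ mcoeffB mcoeffU1 (mcoeff_outdom rP).
have [<-|nPQ] := eqVneq Q P; first by rewrite sub0r mulrN1 subrr eqxx.
rewrite subr0 mulr0 addr0 mcoeff_neq0 => Px.
have [|[wP]] := hx P Px nP; first by left.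
by rewrite inE eq_sym (negbTE nPQ) /=; right.
Qed.

Lemma reduces_ex (x : HSP K) : {y | reduces x y & HHOF y}.
Proof.
have H N : forall x : HSP K, bad_below N x -> {y | reduces x y & HHOF y}.
  elim: N => [|N IHN] {}x bx.
    exists x; first exact: reduces_refl.
    by move=> P Px; apply: contraT => /(bx P Px).
  apply: (reduces_ex_aux IHN (s := enum_fset (msupp x))) => P Px nP.
  by have := bx P Px nP; rewrite ltnS leq_eqVlt => /orP[/eqP ->|->]; [right|left].
apply: (H (\sum_(P <- msupp x) weight P).+1%N) => P Px _.
by rewrite ltnS (big_rem P) //= leq_addr.
Qed.

End Existence.

(* Upsilon(P) is a linear combination of heap-ordered forests obtained from P
   by repeated application of (T1) and (T2). *)
Definition Upsilon_basis (K : fieldType) (P : sposet) : HSP K :=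
  s2val (reduces_ex (<< P >> : HSP K)).

Lemma Upsilon_basisP (K : fieldType) (P : sposet) :
  reduces << P >> (Upsilon_basis K P) /\ HHOF (Upsilon_basis K P).
Proof. by rewrite /Upsilon_basis; case: reduces_ex. Qed.

Definition Upsilon (K : fieldType) : HSP K -> HSP K :=
  lin_ext (Upsilon_basis K).

(* Main.v *)
Require Import Defs.
From mathcomp Require Import all_boot all_order all_algebra finmap.
From mathcomp Require Import monalg.
From HB Require Import structures.
From mathcomp Require Import zify perm.

Set Implicit Arguments.
Unset Strict Implicit.
Unset Printing Implicit Defensive.

Import GRing.Theory.

Local Open Scope ring_scope.

(** Identify a special poset P with a partial order <=_1 on {0, ..., n-1}, the
    second order being the usual one.  A linear extension of P is then a word w
    listing 0, ..., n-1 once each, in which i comes before j whenever i <_1 j.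
    For a word w, the linear form [theta w] sends P to 1 or 0 according to
    whether w is a linear extension of P; the family of all [theta w] is the map
    Theta to FQSym, read coordinate by coordinate.

    The rewriting rules do not change any [theta w] ([theta_T_step]): they
    express the disjointness or the complementarity of the conditions that the
    edges put on the relative order of two or three letters of w.  Moreover
    [theta] separates the combinations of heap-ordered forests ([HHOF_theta0]):
    a forest is known from the parents of its vertices, and when the largest
    letter is inserted in a word of the others, the first admissible position
    betrays its parent.  Hence Upsilon x is the only combination of heap-ordered
    forests with the same [theta] as x.

    Consequently Upsilon commutes with every operation whose effect on [theta]
    depends on the [theta] of the arguments only.  For the product, cut a word
    into its small and its large letters ([theta_mul]).  For the coproduct, cut
    it into a prefix and a suffix ([theta2_coproduct]).  The number
    of pictures between P and Q is the number of permutations s such that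
    s^-1 is a linear extension of P and s one of Q ([card_pictures]), so the
    pairing too depends on [theta] only ([pairing_theta]).  The antipode is
    determined by the product and the coproduct.  All this holds on
    the whole algebra of special posets.

    What is proper to special plane posets is that they correspond to
    permutations, through their pairs of elements in natural order
    ([special_plane_word]).  The linear extensions of the poset of a permutation
    form the interval of the weak order below this permutation
    ([linext_word_poset]), so the matrix of [theta] on special plane posets is
    unitriangular: [theta] is injective on their span ([HSPP_theta0]), and the
    dual basis of the [theta w] lies in it ([theta_delta]).  This gives the
    bijectivity of the restriction of Upsilon; and pairing a combination of
    heap-ordered forests with the images of the dual basis under Upsilon reads
    off all its [theta w], hence the nondegeneracy. *)

(** * Linear maps given on a basis *)

Section LinearExtension.
Context (K : fieldType) (T : choiceType).

Lemma malgUZ (a : K) (t : T) : << a *g t >> = a *: << t >> :> {malg K[T]}.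
Proof. by apply/malgP => s; rewrite mcoeffZ !mcoeffU mulr_natr. Qed.

Lemma malg_basisE (x : {malg K[T]}) : x = \sum_(t <- msupp x) x@_t *: << t >>.
Proof.
by rewrite {1}[x]monalgE; apply: eq_bigr => t _; apply: malgUZ.
Qed.

Lemma malg_ind (P : {malg K[T]} -> Prop) :
  P 0 -> (forall a t x, P x -> P (a *: << t >> + x)) -> forall x, P x.
Proof.
move=> P0 PD x; rewrite [x]malg_basisE.
by elim/big_rec: _ => // t y _; apply: PD.
Qed.

Context (V : lmodType K) (f : T -> V).

Lemma lin_extEw (d : {fset T}) (x : {malg K[T]}) :
  (msupp x `<=` d)%fset -> lin_ext f x = \sum_(t <- d) x@_t *: f t.
Proof.
move=> le; rewrite /lin_ext (big_fset_incl _ le) // => t _ /mcoeff_outdom ->.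
by rewrite scale0r.
Qed.

Lemma lin_ext_is_linear : linear (lin_ext f).
Proof.
move=> a x y; pose d := (msupp (a *: x + y) `|` (msupp x `|` msupp y))%fset.
rewrite !(@lin_extEw d) ?fsubsetUl //; try by rewrite !fsubsetU ?fsubset_refl ?orbT.
rewrite scaler_sumr -big_split; apply: eq_bigr => t _ /=.
by rewrite mcoeffD mcoeffZ scalerDl scalerA.
Qed.

HB.instance Definition _ := GRing.isLinear.Build K {malg K[T]} V *:%R (lin_ext f)
  lin_ext_is_linear.

Lemma lin_ext_sum I (r : seq I) (F : I -> {malg K[T]}) (Q : pred I) :
  lin_ext f (\sum_(i <- r | Q i) F i) = \sum_(i <- r | Q i) lin_ext f (F i).
Proof. exact: linear_sum. Qed.

Lemma lin_extUZ a t : lin_ext f << a *g t >> = a *: f t.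
Proof. by rewrite malgUZ linearZ /= lin_extU. Qed.

End LinearExtension.

(** The analogue of [spanned_by] for any basis; the tensor square needs it too. *)
Definition in_span (K : fieldType) (T : choiceType) (A : T -> Prop)
    (x : {malg K[T]}) : Prop :=
  forall t, t \in msupp x -> A t.

Section Spans.
Context (K : fieldType) (T : choiceType) (A : T -> Prop).
Implicit Types x y : {malg K[T]}.

Lemma in_span0 : in_span A (0 : {malg K[T]}).
Proof. by move=> t; rewrite msupp0. Qed.

Lemma in_spanD x y : in_span A x -> in_span A y -> in_span A (x + y).
Proof.
by move=> hx hy t /(fsubsetP (msuppD_le _ _)); rewrite in_fsetU => /orP[/hx|/hy].
Qed.

Lemma in_spanZ a x : in_span A x -> in_span A (a *: x).
Proof. by move=> hx t /(fsubsetP (msuppZ_le _ _)) /hx. Qed.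

Lemma in_spanB x y : in_span A x -> in_span A y -> in_span A (x - y).
Proof. by move=> hx hy; rewrite -scaleN1r; apply: in_spanD => //; apply: in_spanZ. Qed.

Lemma in_spanU a t : A t -> in_span A (<< a *g t >> : {malg K[T]}).
Proof. by move=> At s /(fsubsetP msuppU_le); rewrite in_fset1 => /eqP ->. Qed.

Lemma in_span_sum I (r : seq I) (Q : pred I) (F : I -> {malg K[T]}) :
  (forall i, Q i -> in_span A (F i)) -> in_span A (\sum_(i <- r | Q i) F i).
Proof.
move=> h; elim/big_rec: _ => [|i x Qi hx]; first exact: in_span0.
exact: in_spanD (h i Qi) hx.
Qed.

Lemma in_span_lin_ext (S : choiceType) (B : S -> Prop) (f : S -> {malg K[T]})
    (x : {malg K[S]}) :
  (forall s, B s -> in_span A (f s)) -> in_span B x -> in_span A (lin_ext f x).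
Proof.
move=> hf Bx; rewrite /lin_ext big_seq; apply: in_span_sum => s /Bx Bs.
exact/in_spanZ/hf.
Qed.

End Spans.

(** * Linear extensions as words *)

(** The first order carried over to natural numbers: letters of words keep their type
    when the size of the poset changes. *)
Definition nat_le1 (P : sposet) : rel nat := fun a b =>
  [exists p in sp_rel P, (val p.1 == a) && (val p.2 == b)].

Lemma nat_le1P (P : sposet) a b :
  reflect (exists i j, [/\ (i, j) \in sp_rel P, a = val i & b = val j]) (nat_le1 P a b).
Proof.
apply: (iffP exists_inP) => [[[i j] ij /andP[/eqP <- /eqP <-]]|[i [j [ij -> ->]]]].
  by exists i, j.
by exists (i, j) => //=; rewrite !eqxx.
Qed.

Lemma nat_le1_ord (P : sposet) (i j : 'I_(sp_size P)) :
  nat_le1 P i j = ((i, j) \in sp_rel P).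
Proof.
apply/nat_le1P/idP => [[i' [j' [h /val_inj -> /val_inj ->]]] //|h].
by exists i, j.
Qed.

(** The second condition forbids a letter to come after one that lies above it; as
    a property of pairs of positions it is compatible with concatenation,
    restriction to some letters and relabelling. *)
Definition linext (P : sposet) (w : seq nat) : bool :=
  perm_eq w (iota 0 (sp_size P)) && pairwise (fun a b => ~~ nat_le1 P b a) w.

Lemma pairwise_index (T : eqType) (r : rel T) (w : seq T) : uniq w ->
  reflect {in w &, forall a b, r a b -> (index a w <= index b w)%N}
          (pairwise (fun a b => ~~ r b a) w).
Proof.
move=> uw; apply: (iffP idP) => [pw a b aw bw rab|h].
  rewrite leqNgt; apply/negP => lt.
  have := pairwiseP a pw (index b w) (index a w).
  by rewrite !inE !index_mem !nth_index // => /(_ bw aw lt) /negP.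
case: w uw h => [//|x0 w']; set w := x0 :: w' => uw h.
apply/(pairwiseP x0) => i j; rewrite !inE => iw jw ij; apply/negP.
by move/(h _ _ (mem_nth _ jw) (mem_nth _ iw)); rewrite !index_uniq // leqNgt ij.
Qed.

Lemma perm_iota_uniq n w : perm_eq w (iota 0 n) -> uniq w.
Proof. by move/perm_uniq ->; apply: iota_uniq. Qed.

Lemma perm_iota_mem n w : perm_eq w (iota 0 n) -> forall k, (k \in w) = (k < n)%N.
Proof. by move/perm_mem => h k; rewrite h mem_iota. Qed.

Lemma perm_iota_size n w : perm_eq w (iota 0 n) -> size w = n.
Proof. by move/perm_size; rewrite size_iota. Qed.

Lemma linextP (P : sposet) w : perm_eq w (iota 0 (sp_size P)) ->
  reflect (forall i j, (i, j) \in sp_rel P -> (index (val i) w <= index (val j) w)%N)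
          (linext P w).
Proof.
move=> pw; rewrite /linext pw /=.
apply: (iffP (pairwise_index _ (perm_iota_uniq pw))) => [h i j ij|h a b _ _].
  by apply: h; rewrite ?(perm_iota_mem pw) ?ltn_ord // nat_le1_ord.
by case/nat_le1P=> i [j [/h le -> ->]].
Qed.

Section Theta.
Context (K : fieldType).
Implicit Types x y : HSP K.

(** The coordinate on w of the image of x in FQSym. *)
Definition theta (w : seq nat) (x : HSP K) : K :=
  lin_ext (fun P => (linext P w)%:R : K^o) x.

Lemma thetaU P w : theta w << P >> = (linext P w)%:R.
Proof. exact: (lin_extU (V := K^o)). Qed.

Lemma thetaE w x : theta w x = \sum_(P <- msupp x) x@_P * (linext P w)%:R.
Proof. by []. Qed.

Lemma thetaD w x y : theta w (x + y) = theta w x + theta w y.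
Proof. exact: (linearD (lin_ext (V := K^o) _)). Qed.

Lemma thetaB w x y : theta w (x - y) = theta w x - theta w y.
Proof. exact: (linearB (lin_ext (V := K^o) _)). Qed.

Lemma thetaZ w a x : theta w (a *: x) = a * theta w x.
Proof. exact: (linearZ_LR (lin_ext (V := K^o) _)). Qed.

Lemma theta_sum w I (r : seq I) (Q : pred I) (F : I -> HSP K) :
  theta w (\sum_(i <- r | Q i) F i) = \sum_(i <- r | Q i) theta w (F i).
Proof. exact: (lin_ext_sum (V := K^o)). Qed.

End Theta.

(** * The rewriting rules preserve theta *)

Section Rules.

Definition obeys (w : seq nat) n (R : {set 'I_n * 'I_n}) : bool :=
  [forall p in R, (index (val p.1) w <= index (val p.2) w)%N].

Lemma obeysU w n (R S : {set 'I_n * 'I_n}) :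
  obeys w (R :|: S) = obeys w R && obeys w S.
Proof.
apply/forall_inP/andP => [h|[/forall_inP hR /forall_inP hS] p].
  by split; apply/forall_inP => p pR; apply: h; rewrite inE pR ?orbT.
by rewrite inE => /orP[/hR|/hS].
Qed.

Lemma obeys1 w n (i j : 'I_n) :
  obeys w [set (i, j)] = (index (val i) w <= index (val j) w)%N.
Proof.
apply/forall_inP/idP => [|h p]; first by move/(_ (i, j)); rewrite inE; apply.
by rewrite inE => /eqP ->.
Qed.

(** Along a path the positions in w increase, so a relation and its
    reflexive-transitive closure impose the same condition on w. *)
Lemma linext_reorder n (R : {set 'I_n * 'I_n}) w : acyclic R ->
  linext (reorder R) w = perm_eq w (iota 0 n) && obeys w R.
Proof.
move=> aR; have [pw|npw] := boolP (perm_eq w (iota 0 n)); last first.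
  by rewrite /linext /= (negbTE npw).
apply/(linextP (P := reorder R) pw)/forall_inP => /= [h [i j] ij /=|h i j].
  by apply: h; rewrite inE aR; apply: connect1.
rewrite inE aR /= => /connectP[p]; elim: p i => [|k p IH] i /=; first by move=> _ ->.
by case/andP=> /h/= le pk /(IH _ pk); apply: leq_trans.
Qed.

Lemma reorder_hasse (Q : sposet) : reorder (sp_hasse Q) = Q.
Proof.
case: Q => n r p; apply: sposet_eq; apply/setP => -[i j].
rewrite inE (acyclic_sub (subxx _)) /=.
apply/idP/idP; last exact: (@reach_hasse (SPoset p)).
exact: (reach_sub (Q := SPoset p) (subxx _)).
Qed.

Lemma linext_hasse (Q : sposet) w :
  linext Q w = perm_eq w (iota 0 (sp_size Q)) && obeys w (sp_hasse Q).
Proof. by rewrite -{1}[Q]reorder_hasse linext_reorder // (acyclic_sub (subxx _)). Qed.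

Lemma index_perm_eq n w (i j : 'I_n) : perm_eq w (iota 0 n) ->
  index (val i) w = index (val j) w -> i = j.
Proof.
move=> pw e; apply/val_inj; rewrite -[LHS](@nth_index _ 0%N _ w).
  by rewrite e nth_index // (perm_iota_mem pw) ltn_ord.
by rewrite (perm_iota_mem pw) ltn_ord.
Qed.

Context (K : fieldType).

(** With a, b, c the positions in w of i, j, k, the rules amount to
    [b < a] = 1 - [a < b] and
    [a < c][b < c] = [a < c] - [a < c][a < b] + [a < b][b < c],
    multiplied by the condition given by the common edges. *)
Lemma theta_T_step (Q : sposet) (r : HSP K) w :
  T_step Q r -> theta w r = theta w << Q >>.
Proof.
have [pw|npw] := boolP (perm_eq w (iota 0 (sp_size Q))); last first.
  have z P : sp_size P = sp_size Q -> theta w (<< P >> : HSP K) = 0.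
    by move=> e; rewrite thetaU /linext e (negbTE npw).
  by case=> [R i j _ _|R i j k _ _ _ _]; rewrite !(thetaB, thetaD) !z // subrr ?add0r.
have idx := index_perm_eq pw.
case=> [R i j ij Rji|R i j k ij jk Rik Rjk];
  rewrite !(thetaB, thetaD) !thetaU (linext_hasse Q) pw /=.
  have [a1 a2] := T1_acyclic Rji.
  rewrite !linext_reorder // pw /= obeysU obeys1 -/R.
  rewrite -[in RHS](setD1K Rji) [in RHS]obeysU obeys1.
  have nij : i <> j by move=> e; rewrite e ltnn in ij.
  (* If a common edge is violated then all the terms vanish. *)
  case: (obeys w _) => /=; last by rewrite andbF subrr.
  case: ltngtP => [||/idx//] _; by rewrite ?subrr ?subr0.
have [a1 a2] := T2_acyclic ij jk Rik Rjk.
have a3 := T2_acyclic' ij jk Rik Rjk.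
rewrite !linext_reorder // pw /=.
have eR : R :\ (j, k) = [set (i, k)] :|: (R :\: [set (j, k); (i, k)]).
  rewrite -setDDl setD1K // in_setD1 Rik andbT xpair_eqE eqxx andbT.
  by apply/eqP => e; rewrite e ltnn in ij.
rewrite -/R -[in RHS](setD1K Rjk) eR.
rewrite !obeysU !obeys1.
have nij : i <> j by move=> e; rewrite e ltnn in ij.
have njk : j <> k by move=> e; rewrite e ltnn in jk.
case: (obeys w _) => /=; last by rewrite !andbF /= !(subr0, addr0).
rewrite !andbT.
case: (ltngtP (index _ w) (index (val j) w)) => [l1|l1|/idx//] /=;
case: (ltngtP (index (val j) w) (index (val k) w)) => [l2|l2|/idx//] /=;
rewrite ?andbT ?andbF /= ?(subrr, subr0, addr0, add0r) //.
- by rewrite (ltnW (ltn_trans l1 l2)).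
- by rewrite leqNgt (ltn_trans l2 l1).
Qed.

Lemma theta_reduces (x y : HSP K) w : reduces x y -> theta w y = theta w x.
Proof.
elim=> // {}x {}y Q r _ /(theta_T_step w) e _ ->.
by rewrite thetaD thetaZ thetaB e subrr mulr0 addr0.
Qed.

Lemma T_step_homogeneous (Q : sposet) (r : HSP K) :
  T_step Q r -> homogeneous (sp_size Q) r.
Proof.
by case=> [R i j _ _ P|R i j k _ _ _ _ P]; [case/msupp_stepB|case/msupp_stepD] => ->.
Qed.

Lemma reduces_homogeneous n (x y : HSP K) :
  reduces x y -> homogeneous n x -> homogeneous n y.
Proof.
elim=> // {}x {}y Q r Qx Qr _ IH hx; apply: IH; apply: in_spanD => //.
have eQ := hx Q Qx.
apply: in_spanZ; apply: in_spanB; last exact: in_spanU.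
by rewrite -eQ; apply: T_step_homogeneous.
Qed.

Lemma theta_Upsilon_basis P w : theta w (Upsilon_basis K P) = theta w << P >>.
Proof. by have [/theta_reduces ->] := Upsilon_basisP K P. Qed.

Lemma theta_Upsilon (x : HSP K) w : theta w (Upsilon x) = theta w x.
Proof.
rewrite {2}[x]malg_basisE /Upsilon {1}/lin_ext !theta_sum; apply: eq_bigr => P _.
by rewrite !thetaZ theta_Upsilon_basis.
Qed.

Lemma Upsilon_basis_homogeneous P : homogeneous (sp_size P) (Upsilon_basis K P).
Proof.
have [h _] := Upsilon_basisP K P.
by apply: reduces_homogeneous h _; apply: in_spanU.
Qed.

Lemma Upsilon_homogeneous n (x : HSP K) : homogeneous n x -> homogeneous n (Upsilon x).
Proof. by apply: in_span_lin_ext => P <-; apply: Upsilon_basis_homogeneous. Qed.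

Lemma Upsilon_HHOF (x : HSP K) : HHOF (Upsilon x).
Proof.
apply: (in_span_lin_ext (B := fun=> True)) => // P _.
by have [] := Upsilon_basisP K P.
Qed.

End Rules.

(** * Heap-ordered forests *)

Lemma nat_le1_lt (P : sposet) a b :
  nat_le1 P a b -> (a < sp_size P)%N /\ (b < sp_size P)%N.
Proof. by case/nat_le1P => i [j [_ -> ->]]; rewrite !ltn_ord. Qed.

Lemma nat_le1_refl (P : sposet) a : (a < sp_size P)%N -> nat_le1 P a a.
Proof.
move=> lt; have [r _ _] := porderP _ (sp_po P).
by rewrite (nat_le1_ord (Ordinal lt) (Ordinal lt)); apply: r.
Qed.

Lemma nat_le1_trans (P : sposet) : transitive (nat_le1 P).
Proof.
move=> b a c /nat_le1P[i [j [ij -> ->]]] /nat_le1P[j' [k [jk /val_inj ej ->]]].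
rewrite -{j'}ej in jk.
have [_ _ t] := porderP _ (sp_po P).
by rewrite nat_le1_ord; apply: t ij jk.
Qed.

Lemma sposet_ext (P Q : sposet) :
  sp_size P = sp_size Q -> nat_le1 P =2 nat_le1 Q -> P = Q.
Proof.
case: P Q => n r p [m s q] /= e; case: m / e s q => s q h.
apply: sposet_eq; apply/setP => -[i j].
by have := h i j; rewrite (@nat_le1_ord (SPoset p)) (@nat_le1_ord (SPoset q)).
Qed.

Lemma hof_le (P : sposet) a b : is_hof P -> nat_le1 P a b -> (a <= b)%N.
Proof.
case/andP=> _ /forallP h /nat_le1P[i [j [ij -> ->]]].
by have /forallP/(_ j)/implyP := h i; apply.
Qed.

Lemma hof_comparable (P : sposet) a b c :
  is_hof P -> nat_le1 P a c -> nat_le1 P b c -> nat_le1 P a b || nat_le1 P b a.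
Proof.
case/andP=> /forallP h _ /nat_le1P[i [k [ik -> ->]]].
move=> /nat_le1P[j [k' [jk -> /val_inj ek]]].
rewrite -{k'}ek in jk; rewrite !nat_le1_ord.
have /forallP/(_ i)/forallP/(_ j)/implyP := h k; rewrite /= ik jk; exact.
Qed.

(** In a heap-ordered forest the parent of k is the largest element strictly below
    k.  It is shifted by one so that 0 stands for a root. *)
Definition parent_code (P : sposet) (k : nat) : nat :=
  \max_(i < sp_size P | (i < k)%N && nat_le1 P i k) i.+1.

Definition code (P : sposet) : seq nat := mkseq (parent_code P) (sp_size P).

Lemma parent_code_spec (P : sposet) k : parent_code P k = 0%N \/
  exists j, [/\ parent_code P k = j.+1, (j < k)%N & nat_le1 P j k].
Proof.
rewrite /parent_code; elim/big_ind: _ => [|m m' hm hm'|i /andP[ik Pik]].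
- by left.
- by case: (leqP m m').
- by right; exists i.
Qed.

Lemma parent_codeP (P : sposet) j k :
  parent_code P k = j.+1 -> (j < k)%N /\ nat_le1 P j k.
Proof. by case: (parent_code_spec P k) => [->//|[i [-> ? ?] [<-]]]. Qed.

Lemma parent_code_factor (P : sposet) i k : is_hof P -> (i < k)%N -> nat_le1 P i k ->
  exists2 j, parent_code P k = j.+1 & nat_le1 P i j.
Proof.
move=> hP ik Pik; have [iP kP] := nat_le1_lt Pik.
have le : (i.+1 <= parent_code P k)%N.
  rewrite /parent_code (bigD1 (Ordinal iP)) /=; last by rewrite ik.
  exact: leq_maxl.
case: (parent_code_spec P k) => [e|[j [e jk Pjk]]]; first by rewrite e in le.
exists j => //; rewrite e ltnS in le.
have [//|Pji] := orP (hof_comparable hP Pik Pjk).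
have -> : i = j by apply/eqP; rewrite eqn_leq le (hof_le hP Pji).
by apply: nat_le1_refl; case: (nat_le1_lt Pjk).
Qed.

Lemma parent_code_le (P : sposet) k : (parent_code P k <= k)%N.
Proof. by case: (parent_code_spec P k) => [->//|[j [-> ? _]]]. Qed.

Lemma nth_code (P : sposet) k : (k < sp_size P)%N -> nth 0%N (code P) k = parent_code P k.
Proof. exact: nth_mkseq. Qed.

Lemma size_code (P : sposet) : size (code P) = sp_size P.
Proof. exact: size_mkseq. Qed.

(** The order is recovered from the parents by induction on the upper vertex: i is
    below k when it equals k or lies below the parent of k. *)
Lemma code_inj (P Q : sposet) : is_hof P -> is_hof Q -> code P = code Q -> P = Q.
Proof.
move=> hP hQ e; have eS : sp_size P = sp_size Q by rewrite -!size_code e.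
suff sub (P1 P2 : sposet) : is_hof P1 -> sp_size P1 = sp_size P2 ->
    code P1 = code P2 -> subrel (nat_le1 P1) (nat_le1 P2).
  by apply: sposet_ext => // i k; apply/idP/idP; apply: sub.
move=> {}hP {}eS {}e i k; elim/ltn_ind: k i => k IH i Pik.
have [iP kP] := nat_le1_lt Pik.
have := hof_le hP Pik; rewrite leq_eqVlt => /orP[/eqP ->|ik].
  by apply: nat_le1_refl; rewrite -eS.
have [j ej Pij] := parent_code_factor hP ik Pik.
have ej2 : parent_code P2 k = j.+1 by rewrite -nth_code -?eS // -e nth_code.
have [jk P2jk] := parent_codeP ej2.
by apply: nat_le1_trans P2jk; apply: IH.
Qed.

(** The number of letters of w up to the parent encoded by p: a new letter may be
    inserted in w after its parent exactly at the positions at least [slot p w]. *)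
Definition slot (p : nat) (w : seq nat) : nat :=
  if p is j.+1 then (index j w).+1 else 0%N.

Definition obeys_code (s w : seq nat) : bool :=
  all (fun k => (slot (nth 0%N s k) w <= index k w)%N) (iota 0 (size s)).

(** It suffices to compare each vertex with its parent, by induction on the vertex. *)
Lemma linext_code (P : sposet) w : is_hof P ->
  perm_eq w (iota 0 (sp_size P)) -> linext P w = obeys_code (code P) w.
Proof.
move=> hP pw; have idx i k : (i < sp_size P)%N -> (i < k)%N -> index i w != index k w.
  move=> iP ik; apply: contraTneq ik => e.
  have iw : i \in w by rewrite (perm_iota_mem pw).
  have kw : k \in w by rewrite -index_mem -e index_mem.
  by rewrite -(nth_index 0%N iw) e (nth_index 0%N kw) ltnn.
apply/(linextP pw)/allP => [h k|h i k ik].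
  rewrite mem_iota size_code /= => kP; rewrite nth_code //.
  case e: (parent_code P k) => [//|j] /=.
  have [jk Pjk] := parent_codeP e; have [jP _] := nat_le1_lt Pjk.
  rewrite ltn_neqAle idx //=.
  by apply: (h (Ordinal jP) (Ordinal kP)); rewrite -nat_le1_ord.
suff main b a : nat_le1 P a b -> (index a w <= index b w)%N.
  by apply: main; rewrite nat_le1_ord.
elim/ltn_ind: b a => {ik}k IH {}i Pik.
have [iP kP] := nat_le1_lt Pik.
have := hof_le hP Pik; rewrite leq_eqVlt => /orP[/eqP -> //|ik].
have [j ej Pij] := parent_code_factor hP ik Pik.
have [jk _] := parent_codeP ej.
have := h k; rewrite mem_iota size_code /= kP => /(_ isT).
rewrite nth_code // ej /= => /ltnW; apply: leq_trans; exact: IH.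
Qed.

(** The sequences that encode a choice, for each k < n, of a smaller parent or of no
    parent. *)
Fixpoint codes (n : nat) : seq (seq nat) :=
  if n is n'.+1 then [seq rcons s p | s <- codes n', p <- iota 0 n] else [:: [::]].

Lemma codesSP n s : s \in codes n.+1 ->
  exists s' p, [/\ s' \in codes n, (p <= n)%N & s = rcons s' p].
Proof.
rewrite /codes -/codes => /allpairsP[[s' p]] [s'n /=].
rewrite -[X in p \in X]/(iota 0 n.+1) mem_iota ltnS => pn ->.
by exists s', p.
Qed.

Lemma size_codes n s : s \in codes n -> size s = n.
Proof.
elim: n s => [|n IH] s; first by rewrite inE => /eqP ->.
by case/codesSP => [s' [p [/IH e _ ->]]]; rewrite size_rcons e.
Qed.

Lemma nth_codes n s k : s \in codes n -> (nth 0%N s k <= k)%N.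
Proof.
elim: n s => [|n IH] s; first by rewrite inE => /eqP ->; rewrite nth_nil.
case/codesSP => [s' [p [s'n pn ->]]]; rewrite nth_rcons (size_codes s'n).
by case: ltngtP => // [_|->]; first exact: IH.
Qed.

Lemma uniq_codes n : uniq (codes n).
Proof.
elim: n => //= n IH; apply: (@allpairs_uniq _ _ _ rcons (codes n) (iota 0 n.+1)) => //.
  exact: iota_uniq.
by move=> [s p] [t q] _ _ /= /rcons_inj[-> ->].
Qed.

Lemma code_in_codes (P : sposet) : code P \in codes (sp_size P).
Proof.
rewrite /code; elim: (sp_size P) => [|n IH]; first by rewrite inE.
rewrite /mkseq -addn1 iotaD map_cat cats1 /=.
by rewrite addn1; apply: allpairs_f => //; rewrite mem_iota ltnS parent_code_le.
Qed.

Section Insertion.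
Variables (n r : nat) (w : seq nat).
Hypotheses (pw : perm_eq w (iota 0 n)) (rn : (r <= n)%N).

Let w' := take r w ++ n :: drop r w.

Lemma perm_insertion : perm_eq w' (iota 0 n.+1).
Proof.
have -> : iota 0 n.+1 = rcons (iota 0 n) n by rewrite -addn1 iotaD cats1.
rewrite perm_sym perm_rcons perm_sym perm_catC cat_cons perm_cons perm_catC.
by rewrite cat_take_drop.
Qed.

Lemma index_insertion_new : index n w' = r.
Proof.
have ntake : n \notin take r w.
  by apply/negP => /mem_take; rewrite (perm_iota_mem pw) ltnn.
by rewrite index_cat (negbTE ntake) /= eqxx addn0 size_takel // (perm_iota_size pw).
Qed.

Lemma index_insertion k : (k < n)%N -> index k w' = (index k w + (r <= index k w))%N.
Proof.
move=> kn; have sz : size (take r w) = r by rewrite size_takel // (perm_iota_size pw).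
rewrite -[in RHS](cat_take_drop r w) /w' !index_cat /= sz.
case: ifP => h; last by rewrite gtn_eqF //= leq_addr addnS addn1.
by have := h; rewrite -index_mem sz ltnNge => /negbTE ->; rewrite addn0.
Qed.

Lemma slot_insertion p : (p <= n)%N -> (slot p w' <= r)%N = (slot p w <= r)%N.
Proof. by case: p => //= j jn; rewrite index_insertion //; lia. Qed.

Lemma obeys_code_insertion s p : s \in codes n -> (p <= n)%N ->
  obeys_code (rcons s p) w' = obeys_code s w && (slot p w <= r)%N.
Proof.
move=> sn pn; have szs := size_codes sn.
rewrite /obeys_code size_rcons -[(size s).+1]addn1 iotaD all_cat /= andbT.
rewrite nth_rcons szs ltnn eqxx index_insertion_new slot_insertion //.
congr (_ && _); apply: eq_in_all => k; rewrite mem_iota /= => kn.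
rewrite nth_rcons szs kn index_insertion //.
have := nth_codes k sn; case: (nth _ _ _) => //= j jk.
by rewrite index_insertion; lia.
Qed.

End Insertion.

Lemma slot_inj n w : perm_eq w (iota 0 n) -> {in iota 0 n.+1 &, injective (slot^~ w)}.
Proof.
move=> pw [|j] [|k] //; rewrite !mem_iota !ltnS => /= jn kn [e].
by congr S; rewrite -(nth_index 0%N (s := w) (x := j)) ?e ?nth_index ?(perm_iota_mem pw).
Qed.

Lemma slot_le n w p : perm_eq w (iota 0 n) -> (p <= n)%N -> (slot p w <= n)%N.
Proof.
move=> pw; case: p => //= j jn.
by rewrite -(perm_iota_size pw) index_mem (perm_iota_mem pw).
Qed.

Section HofInjective.
Context (K : fieldType).

(** Differences of consecutive thresholds isolate the level sets of f, and these have
    at most one element. *)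
Lemma threshold_sums (r : seq nat) (f : nat -> nat) (g : nat -> K) (n : nat) :
  uniq r -> {in r &, injective f} -> {in r, forall p, (f p <= n)%N} ->
  (forall m, (m <= n)%N -> \sum_(p <- r) g p * (f p <= m)%:R = 0) ->
  {in r, forall p, g p = 0}.
Proof.
move=> ur fi fn h p0 p0r.
have {}h m : (m <= n)%N -> \sum_(p <- r) g p * (f p == m)%:R = 0.
  case: m => [|m] mn.
    by apply: etrans (h _ mn); apply: eq_bigr => p _; rewrite leqn0.
  have := congr2 (fun a b => a - b) (h _ mn) (h _ (ltnW mn)).
  rewrite subrr -sumrB; apply: etrans; apply: eq_bigr => p _.
  rewrite -mulrBr [(_ <= m.+1)%N]leq_eqVlt ltnS; congr (_ * _).
  by case: eqP => [->|_] /=; rewrite ?ltnn ?subr0 ?subrr.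
have := h _ (fn _ p0r); rewrite (bigD1_seq p0) //= eqxx mulr1.
rewrite big_seq_cond big1 ?addr0 // => p /andP[pr np].
by case: eqP => [/(fi _ _ pr p0r) e|_]; rewrite ?mulr0 // e eqxx in np *.
Qed.

(** Induction on n, inserting the letter n in a word w of the smaller letters.  For a
    fixed w, the position of n only interacts with the parent p of n, through the
    threshold [slot p w]; by [threshold_sums] the combination of the codes with a
    given last entry p vanishes on w. *)
Lemma codes_free n (c : seq nat -> K) :
  (forall w, perm_eq w (iota 0 n) ->
     \sum_(s <- codes n) c s * (obeys_code s w)%:R = 0) ->
  {in codes n, forall s, c s = 0}.
Proof.
elim: n c => [|n IH] c h s.
  rewrite inE => /eqP ->; have := h [::] (perm_refl _).
  by rewrite big_seq1 mulr1.
case/codesSP => [{}s [p [sn pn ->]]].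
have {}pn : p \in iota 0 n.+1 by rewrite mem_iota ltnS.
apply: (IH (fun t => c (rcons t p))) sn => w pw.
apply: (threshold_sums (r := iota 0 n.+1) (f := slot^~ w) (n := n)
  (g := fun q => \sum_(t <- codes n) c (rcons t q) * (obeys_code t w)%:R)) pn.
- exact: iota_uniq.
- exact: slot_inj.
- by move=> q; rewrite mem_iota ltnS; apply: slot_le.
move=> m mn; have := h _ (perm_insertion m pw).
rewrite big_allpairs_dep /= -[0%N :: _]/(iota 0 n.+1) exchange_big; apply: etrans.
rewrite !big_seq; apply: eq_bigr => q; rewrite mem_iota ltnS => qn.
rewrite mulr_suml !big_seq; apply: eq_bigr => t tn.
by rewrite (obeys_code_insertion pw) // -mulrA -natrM mulnb.
Qed.

(** A relation between the [theta] of heap-ordered forests is a relation between the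
    indicator functions of their codes, and each code comes from one forest. *)
Lemma HHOF_theta0 (x : HSP K) : HHOF x -> (forall w, theta w x = 0) -> x = 0.
Proof.
move=> hx h; apply/malgP => P; rewrite mcoeff0.
have [Px|/mcoeff_outdom//] := boolP (P \in msupp x).
pose c s := \sum_(Q <- msupp x | code Q == s) x@_Q.
have <- : c (code P) = x@_P.
  rewrite /c big_seq_cond (big_rem P) //= Px eqxx /=.
  rewrite big1_seq ?addr0 // => Q /andP[/andP[Qx /eqP eQ]].
  by rewrite (code_inj (hx Q Qx) (hx P Px) eQ) mem_rem_uniqF ?fset_uniq.
apply: (codes_free (n := sp_size P)); last exact: code_in_codes.
move=> w pw; apply: etrans (h w); rewrite thetaE.
under eq_bigr do rewrite mulr_suml.
rewrite (exchange_big_dep xpredT) //= !big_seq; apply: eq_bigr => Q Qx.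
have [eS|nS] := eqVneq (sp_size Q) (sp_size P); last first.
  rewrite big1_seq => [|s /andP[/eqP <-] /size_codes]; last first.
    by rewrite size_code => /eqP; rewrite (negbTE nS).
  rewrite /linext; case: (boolP (perm_eq _ _)) => [/perm_iota_size|_];
    last by rewrite mulr0.
  by rewrite (perm_iota_size pw) => /esym/eqP; rewrite (negbTE nS).
rewrite big_mkcond (bigD1_seq (code Q)) ?uniq_codes -?eS ?code_in_codes //= eqxx.
rewrite big1 ?addr0 => [|s]; last by rewrite eq_sym => /negbTE ->.
by rewrite (linext_code (hx Q Qx)) // eS.
Qed.

End HofInjective.

(** * Special plane posets *)

Section WordPoset.
Variable n : nat.
Implicit Types w v : seq nat.

(** The inversions of w are the pairs i < j that this order leaves out. *)
Definition word_rel w : {set 'I_n * 'I_n} :=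
  [set p | (val p.1 <= val p.2)%N && (index (val p.1) w <= index (val p.2) w)%N].

Lemma word_po w : porderb (fun i j => (i, j) \in word_rel w).
Proof.
apply/porderP; split=> [i|i j|j i k]; rewrite !inE //= ?leqnn //.
  by case/andP=> /andP[ij _] /andP[ji _]; apply/val_inj/eqP; rewrite eqn_leq ij.
by case/andP=> ij ij' /andP[jk jk']; rewrite (leq_trans ij jk) (leq_trans ij' jk').
Qed.

Definition word_poset w : sposet := SPoset (word_po w).

Lemma index_inj w (i j : 'I_n) : perm_eq w (iota 0 n) ->
  (index (val i) w == index (val j) w) = (i == j).
Proof. by move=> pw; apply/eqP/eqP => [/(index_perm_eq pw)|->]. Qed.

(** The companion order relates i <= j when j comes before i in w: two letters are in
    natural order or inverted, not both. *)
Lemma word_poset_special_plane w : perm_eq w (iota 0 n) -> special_plane (word_poset w).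
Proof.
move=> pw.
have po2 : partial_order (fun i j : 'I_n =>
    (val i <= val j)%N && (index (val j) w <= index (val i) w)%N).
  split=> [i|i j|j i k]; rewrite ?leqnn //.
    by case/andP=> /andP[ij _] /andP[ji _]; apply/val_inj/eqP; rewrite eqn_leq ij.
  by case/andP=> ij ij' /andP[jk jk']; rewrite (leq_trans ij jk) (leq_trans jk' ij').
exists (DPoset (porderP _ (word_po w)) po2), id; split=> //=; first last.
- move=> i j; rewrite inE /= -andb_orr.
  by case: (leqP (index _ w) _) => [|/ltnW ->]; rewrite ?andbT ?orbT ?andbT.
- by exists id.
move=> i j nij; rewrite /= !inE /=.
have := index_inj i j pw; rewrite (negbTE nij) => nidx.
have := nij; rewrite -(inj_eq val_inj) /=.
by case: ltngtP nidx => // _; case: ltngtP.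
Qed.

(** The linear extensions of [word_poset v] are the words whose inversions are among
    those of v: they form an interval of the weak order. *)
Lemma linext_word_poset v w : perm_eq w (iota 0 n) ->
  linext (word_poset v) w = (word_rel v \subset word_rel w).
Proof.
move=> pw; apply/(linextP (P := word_poset v) pw)/subsetP => [h [i j] ij|h i j ij].
  by have := h i j ij; rewrite !inE /= in ij *; case/andP: ij => -> _ ->.
by have := h _ ij; rewrite inE => /andP[_].
Qed.

Lemma word_rel_inj v w : perm_eq v (iota 0 n) -> perm_eq w (iota 0 n) ->
  word_rel v = word_rel w -> v = w.
Proof.
move=> pv pw e.
have le (i j : 'I_n) : (index (val i) v <= index (val j) v)%N ->
    (index (val i) w <= index (val j) w)%N.
  move=> ij; case: (leqP i j) => [lij|lji].
    by have /setP/(_ (i, j)) := e; rewrite !inE /= lij ij => /esym.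
  have := index_inj i j pv; have := index_inj i j pw.
  have /setP/(_ (j, i)) := e; rewrite !inE /= (ltnW lji) /=.
  have -> : i == j = false by apply: contraTF lji => /eqP ->; rewrite ltnn.
  by case: ltngtP ij => // _ _; case: ltngtP.
apply: (@pairwise_eq _ (fun a b => ~~ (index b v <= index a v)%N)).
- by move=> a b; rewrite -!ltnNge => /andP[h /(ltn_trans h)]; rewrite ltnn.
- by apply/(pairwise_index _ (perm_iota_uniq pv)).
- apply/(pairwise_index _ (perm_iota_uniq pw)) => a b.
  rewrite !(perm_iota_mem pw) => an bn; exact: (le (Ordinal an) (Ordinal bn)).
- by rewrite (permPl pv) perm_sym.
Qed.

End WordPoset.

(** For a plane poset, let i precede j when i <=_h j or j <=_r i.  This is a total
    order, because each pair is comparable for just one of <=_h and <=_r; the word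
    w lists the elements in this order. *)
Lemma special_plane_word (P : sposet) : special_plane P ->
  exists2 w, perm_eq w (iota 0 (sp_size P)) & P = word_poset (sp_size P) w.
Proof.
case=> E [f [plE bf f1 f2]].
pose n := sp_size P; pose h (i j : 'I_n) := le1 (f i) (f j).
pose r (i j : 'I_n) := le2 (f i) (f j).
have [hr ha ht] := le1_po E; have [rr ra rt] := le2_po E.
have hrN i j : i != j -> (h i j || h j i) = ~~ (r i j || r j i).
  by move=> nij; apply: plE; rewrite (inj_eq (bij_inj bf)).
pose le (i j : 'I_n) := h i j || r j i.
have le_refl : reflexive le by move=> i; rewrite /le /h hr.
have le_total : total le.
  move=> i j; have [->|/hrN] := eqVneq i j; first by rewrite le_refl.
  by rewrite /le; case: (h i j); case: (h j i); case: (r i j); case: (r j i).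
have le_anti : antisymmetric le.
  move=> i j; have [//|nij] := eqVneq i j; rewrite /le => hh.
  have := hrN _ _ nij; have nh : h i j && h j i = false.
    by apply: contra_neqF nij => /ha /(bij_inj bf).
  have nr : r i j && r j i = false by apply: contra_neqF nij => /ra /(bij_inj bf).
  by move: hh nh nr; case: (h i j); case: (h j i); case: (r i j); case: (r j i).
have le_trans : transitive le.
  move=> j i k; have [->//|nij] := eqVneq i j; have [->//|njk] := eqVneq j k.
  have [->|nik] := eqVneq i k; first by rewrite le_refl.
  (* Only the mixed cases need the plane condition: each way of failing to be
     related as required produces a pair comparable for both orders. *)
  case/orP=> ij /orP jk.
  - case: jk => jk; first by rewrite /le /h (ht _ _ _ ij jk).
    have := hrN _ _ nik; rewrite /le; case ik: (h i k) => //; case ki: (r k i) => //.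
    case hki: (h k i); case rik: (r i k) => // _.
      by have := hrN _ _ njk; rewrite jk orbT /h (ht _ _ _ hki ij) orbT.
    by have := hrN _ _ nij; rewrite ij /r (rt _ _ _ rik jk).
  - case: jk => jk; last by rewrite /le /r (rt _ _ _ jk ij) orbT.
    have := hrN _ _ nik; rewrite /le; case ik: (h i k) => //; case ki: (r k i) => //.
    case hki: (h k i); case rik: (r i k) => // _.
      by have := hrN _ _ nij; rewrite ij orbT /h (ht _ _ _ jk hki) orbT.
    by have := hrN _ _ njk; rewrite jk /r (rt _ _ _ ij rik).
pose s := sort le (enum 'I_n); pose w := [seq val i | i <- s].
have pw : perm_eq w (iota 0 n).
  by rewrite -val_enum_ord; apply: perm_map; rewrite perm_sort.
have mem_s i : i \in s by rewrite mem_sort mem_enum.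
have idx i j : (index (val i) w <= index (val j) w)%N = le i j.
  rewrite !index_map; try exact: val_inj.
  have srt : sorted le s by apply: sort_sorted.
  have idx_le := sorted_leq_index le_trans le_refl srt.
  apply/idP/idP => [|ij]; first exact: idx_le.
  rewrite leqNgt; apply/negP => lt.
  have ji := idx_le j i (mem_s j) (mem_s i) (ltnW lt).
  by rewrite (le_anti i j) ?ij ?ji // ltnn in lt.
exists w => //; apply: sposet_ext => // a b; apply/idP/idP => [ab|].
  have [aP bP] := nat_le1_lt ab.
  rewrite (@nat_le1_ord (word_poset n w) (Ordinal aP) (Ordinal bP)) inE idx.
  have ab1 : h (Ordinal aP) (Ordinal bP) by rewrite /h -f1 /= -nat_le1_ord.
  by have := f2 (Ordinal aP) (Ordinal bP); rewrite /= -/(h _ _) /le ab1 => ->.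
case/nat_le1P=> i [j [+ -> ->]]; rewrite inE idx => /andP[].
have /= := f2 i j; rewrite -/(h i j) -/(r i j) => -> /=.
rewrite /le nat_le1_ord => h1 h2; have := f1 i j; rewrite /= => ->.
case/orP: h1 => // h1; case/orP: h2 => // h2.
by have /(bij_inj bf) -> := ra (f i) (f j) (introT andP (conj h1 h2)); apply: hr.
Qed.

Section PlaneTriangular.
Context (K : fieldType).

(** Induction on the number of relations of P: among special plane posets, the word
    of P is a linear extension of P and otherwise only of posets with fewer
    relations. *)
Lemma HSPP_theta0 (x : HSP K) : HSPP x -> (forall w, theta w x = 0) -> x = 0.
Proof.
move=> hx h; apply/malgP => P; rewrite mcoeff0.
have [m] := ubnP #|sp_rel P|; elim: m P => // m IH P lt.
have [Px|/mcoeff_outdom//] := boolP (P \in msupp x).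
have [w pw eP] := special_plane_word (hx P Px).
have := h w; rewrite thetaE (big_rem P) //= eP linext_word_poset // subxx -eP mulr1.
rewrite big1_seq ?addr0 // => Q /andP[_ Qx].
have [lQ|] := boolP (linext Q w); last by rewrite mulr0.
have eS : sp_size Q = sp_size P.
  by case/andP: lQ => /perm_iota_size <- _; apply: perm_iota_size.
have Qx' := mem_rem Qx.
have [v pv eQ] := special_plane_word (hx Q Qx').
rewrite eS in pv eQ.
have nQP : Q != P by apply: contraTneq Qx => ->; rewrite mem_rem_uniqF ?fset_uniq.
rewrite IH ?mul0r //; move: lQ; rewrite eQ linext_word_poset // => sub.
apply: leq_trans (_ : #|word_rel (sp_size P) w| <= m)%N; last by rewrite eP in lt.
apply: proper_card; rewrite properEneq sub andbT.
by apply: contraNneq nQP => /(word_rel_inj pv pw) evw; rewrite eQ eP evw.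
Qed.

(** The dual basis, by inversion of a unitriangular matrix.  The argument m only
    bounds the recursion depth. *)
Fixpoint delta n m (w : seq nat) : HSP K :=
  if m is m'.+1 then << word_poset n w >> -
    \sum_(v <- permutations (iota 0 n) | linext (word_poset n w) v && (v != w))
      delta n m' v
  else 0.

(** The words v in the recursive calls have strictly more pairs in natural order
    than w, so m bounds the depth of the recursion. *)
Lemma theta_deltaE n m w u : perm_eq w (iota 0 n) -> (#|~: word_rel n w| < m)%N ->
  theta u (delta n m w) = (u == w)%:R.
Proof.
elim: m w => // m IH w pw lt /=; rewrite thetaB thetaU theta_sum.
have pE v : (v \in permutations (iota 0 n)) = perm_eq v (iota 0 n).
  exact: mem_permutations.
rewrite big_seq_cond (eq_bigr (fun v => (u == v)%:R)); last first.
  move=> v /andP[]; rewrite pE => pv /andP[lv nvw]; apply: IH => //.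
  apply: leq_trans (_ : #|~: word_rel n w| <= m)%N; last by [].
  rewrite linext_word_poset // in lv.
  apply: proper_card; rewrite properEneq setCS lv andbT (inj_eq (@setC_inj _)).
  by apply: contraNneq nvw => /(word_rel_inj pv pw) ->.
have [->|nuw] := eqVneq u w.
  rewrite big1 ?subr0 => [|v /andP[_ /andP[_ nvu]]]; last by rewrite eq_sym (negbTE nvu).
  by rewrite linext_word_poset ?subxx.
have [lu|nlu] := boolP (linext (word_poset n w) u); last first.
  rewrite big1 ?subrr // => v /and3P[_ lv _].
  by case: eqP => // e; rewrite e lv in nlu.
have pu : u \in permutations (iota 0 n) by rewrite pE; case/andP: lu.
rewrite (eq_bigl (fun v => (v \in permutations (iota 0 n)) &&
  (linext (word_poset n w) v && (v != w)))) // -big_seq_cond.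
rewrite big_mkcond (bigD1_seq u) ?permutations_uniq //= lu nuw eqxx /=.
rewrite big1 ?addr0 ?subrr // => v; rewrite [v == u]eq_sym => /negbTE ->.
by case: ifP.
Qed.

Lemma delta_HSPP n m w : perm_eq w (iota 0 n) -> HSPP (delta n m w).
Proof.
elim: m w => [|m IH] w pw; first exact: in_span0.
apply: in_spanB; first by apply: in_spanU; apply: word_poset_special_plane.
rewrite big_seq_cond; apply: in_span_sum => v /andP[pv _]; apply: IH.
by rewrite mem_permutations in pv.
Qed.

Lemma delta_homogeneous n m w : homogeneous n (delta n m w).
Proof.
elim: m w => [|m IH] w; first exact: in_span0.
apply: in_spanB; first exact: in_spanU.
by apply: in_span_sum => v _; apply: IH.
Qed.

Lemma theta_delta n w : perm_eq w (iota 0 n) ->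
  exists x : HSP K, [/\ HSPP x, homogeneous n x & forall u, theta u x = (u == w)%:R].
Proof.
move=> pw; exists (delta n #|~: word_rel n w|.+1 w).
split; [exact: delta_HSPP | exact: delta_homogeneous | move=> u].
exact: theta_deltaE.
Qed.


End PlaneTriangular.

(** * Stability of heap-ordered forests *)

Lemma is_hof_diso (D E : dposet) : diso D E -> is_hof D -> is_hof E.
Proof.
case=> f [[g fK gK] h1 h2] /andP[/forallP hf /forallP hh].
have {}h1 x y : le1 (g x) (g y) = le1 x y by rewrite -h1 !gK.
have {}h2 x y : le2 (g x) (g y) = le2 x y by rewrite -h2 !gK.
apply/andP; split.
  apply/forallP => x; apply/forallP => y; apply/forallP => z.
  by have /forallP/(_ (g y))/forallP/(_ (g z)) := hf (g x); rewrite !h1.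
apply/forallP => x; apply/forallP => y.
by have /forallP/(_ (g y)) := hh (g x); rewrite h1 h2.
Qed.

Lemma is_hof_drestr (D : dposet) (A : {set D}) : is_hof D -> is_hof (drestr A).
Proof.
move=> /andP[/forallP hf /forallP hh]; apply/andP; split.
  apply/forallP => x; apply/forallP => y; apply/forallP => z.
  exact: (forallP (forallP (hf (val x)) (val y)) (val z)).
by apply/forallP => x; apply/forallP => y; apply: (forallP (hh (val x)) (val y)).
Qed.

Lemma is_hof_dsum (D E : dposet) : is_hof D -> is_hof E -> is_hof (dsum D E).
Proof.
move=> /andP[/forallP hf /forallP hh] /andP[/forallP kf /forallP kh].
apply/andP; split.
  apply/forallP => -[x|x]; apply/forallP => -[y|y]; apply/forallP => -[z|z] //=.
  - exact: (forallP (forallP (hf x) y) z).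
  - by rewrite andbF.
  - by rewrite andbF.
  - exact: (forallP (forallP (kf x) y) z).
apply/forallP => -[x|x]; apply/forallP => -[y|y] //=.
  exact: (forallP (hh x) y).
exact: (forallP (kh x) y).
Qed.

Lemma is_hof_std (D : dposet) : special D -> is_hof D -> is_hof (std D).
Proof. by move/diso_std/is_hof_diso; apply. Qed.

Lemma special_drestr (P : sposet) (A : {set (P : dposet)}) : special (drestr A).
Proof. by move=> x y; apply: special_sposet. Qed.

Lemma is_hof_mul (P Q : sposet) : is_hof P -> is_hof Q -> is_hof (sp_mul P Q).
Proof.
move=> hP hQ; apply: is_hof_std (is_hof_dsum hP hQ).
exact: special_dsum (@special_sposet P) (@special_sposet Q).
Qed.

(** * The product *)

Section Product.
Variables P Q : sposet.
Let n := sp_size P.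
Let m := sp_size Q.

Definition cat_rel : {set 'I_(n + m) * 'I_(n + m)} :=
  [set p | @sum_le1 P Q (split p.1) (split p.2)].

Lemma cat_po : porderb (fun i j => (i, j) \in cat_rel).
Proof.
have [r a t] := sum_le1_po P Q.
apply/porderP; split=> [i|i j|j i k]; rewrite !inE /=.
- exact: r.
- by move/a/(can_inj (@splitK n m)).
- exact: t.
Qed.

(** The explicit model on 'I_(n + m) makes the labels of the product computable: those
    of P are kept, those of Q are shifted by n. *)
Lemma sp_mul_cat : sp_mul P Q = SPoset cat_po.
Proof.
apply: diso_sposet; have sPQ := special_dsum (@special_sposet P) (@special_sposet Q).
apply: diso_trans (diso_sym (diso_std sPQ)) _.
exists (@unsplit n m); split.
- by exists (@split n m); [apply: unsplitK | apply: splitK].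
- by move=> u v; rewrite /= inE /= !unsplitK.
move=> [i|i] [j|j] //=; rewrite ?leq_add2l //.
  by rewrite (leq_trans (ltnW (ltn_ord i))) ?leq_addr.
by apply/negbTE; rewrite -ltnNge (leq_trans (ltn_ord j)) ?leq_addr.
Qed.

Lemma nat_le1_mul a b : nat_le1 (sp_mul P Q) a b =
  nat_le1 P a b || [&& (n <= a)%N, (n <= b)%N & nat_le1 Q (a - n)%N (b - n)%N].
Proof.
rewrite sp_mul_cat; apply/nat_le1P/orP => [[i [j [+ -> ->]]]|].
  rewrite inE /=; move: (splitK i) (splitK j).
  case: (split i) => i'; case: (split j) => j' //= <- <- h; [left|right].
    by rewrite nat_le1_ord.
  by rewrite !leq_addr !addKn nat_le1_ord.
case=> [/nat_le1P[i [j [ij -> ->]]]|/and3P[na nb /nat_le1P[i [j [ij ea eb]]]]].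
  exists (lshift m i), (lshift m j); split=> //.
  by rewrite inE /= -[lshift m i]/(unsplit (inl i))
    -[lshift m j]/(unsplit (inl j)) !unsplitK.
exists (rshift n i), (rshift n j); split; rewrite /= -?ea -?eb ?subnKC //.
by rewrite inE /= -[rshift n i]/(unsplit (inr i))
  -[rshift n j]/(unsplit (inr j)) !unsplitK.
Qed.

End Product.

Definition low (n : nat) (w : seq nat) : seq nat := [seq k <- w | (k < n)%N].
Definition high (n : nat) (w : seq nat) : seq nat :=
  [seq (k - n)%N | k <- w & (n <= k)%N].

Lemma pairwise_split (T : Type) (r : rel T) (p : pred T) (w : seq T) :
  (forall a b, p a != p b -> r a b) ->
  pairwise r w = pairwise r (filter p w) && pairwise r (filter (predC p) w).
Proof.
move=> h; elim: w => //= a w ->; case pa: (p a) => /=.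
  rewrite -andbA; congr (_ && _); elim: w => //= b w ->.
  by case pb: (p b) => //=; rewrite h ?pa ?pb.
rewrite andbCA; congr (_ && (_ && _)); elim: w => //= b w ->.
by case pb: (p b) => //=; rewrite h ?pa ?pb.
Qed.

Lemma low_perm n m w : perm_eq w (iota 0 (n + m)) -> perm_eq (low n w) (iota 0 n).
Proof.
move/(perm_filter (fun k => k < n)%N); rewrite iotaD filter_cat => h.
apply: perm_trans h _; rewrite (eq_in_filter (a2 := predT)) => [|k].
  rewrite filter_predT (eq_in_filter (a2 := pred0)) ?filter_pred0 ?cats0 // => k.
  by rewrite mem_iota => /andP[nk _]; rewrite ltnNge nk.
by rewrite mem_iota /= => ->.
Qed.

Lemma high_perm n m w : perm_eq w (iota 0 (n + m)) -> perm_eq (high n w) (iota 0 m).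
Proof.
move/(perm_filter (fun k => n <= k)%N); rewrite iotaD filter_cat => h.
apply: perm_trans (perm_map _ h) _.
rewrite (eq_in_filter (a2 := pred0)) => [|k].
  rewrite filter_pred0 cat0s (eq_in_filter (a2 := predT)) => [|k].
    rewrite filter_predT -[X in iota X]addn0 iotaDl -map_comp.
    by rewrite (eq_map (g := id)) ?map_id // => k /=; rewrite addKn.
  by rewrite mem_iota => /andP[-> _].
by rewrite mem_iota /= add0n => kn; rewrite leqNgt kn.
Qed.

(** The product has no relation between letters of P and letters of Q, so a linear
    extension is a shuffle of two independent ones. *)
Lemma linext_mul (P Q : sposet) w :
  perm_eq w (iota 0 (sp_size P + sp_size Q)) ->
  linext (sp_mul P Q) w = linext P (low (sp_size P) w) && linext Q (high (sp_size P) w).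
Proof.
move=> pw; rewrite /linext sp_size_mul pw (low_perm pw) (high_perm pw) /=.
set n := sp_size P; rewrite (@pairwise_split _ _ (fun k => k < n)%N); last first.
  move=> a b nab; rewrite nat_le1_mul -/n; apply/negP => /orP[/nat_le1_lt[la lb]|].
    by rewrite la lb in nab.
  by case/and3P=> na nb _; rewrite !ltnNge na nb in nab.
congr (_ && _).
  apply: (eq_in_pairwise (P := fun k => k < n)%N); last exact: filter_all.
  move=> a b; rewrite -!topredE /= => an bn.
  by rewrite nat_le1_mul -/n [(n <= b)%N]leqNgt bn orbF.
rewrite pairwise_map (eq_filter (a2 := fun k => n <= k)%N); last first.
  by move=> k /=; rewrite -leqNgt.
apply: (eq_in_pairwise (P := fun k => n <= k)%N); last exact: filter_all.
move=> a b; rewrite -!topredE /= => na nb.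
rewrite nat_le1_mul -/n na nb /=; case: (boolP (nat_le1 P b a)) => // /nat_le1_lt[+ _].
by rewrite ltnNge nb.
Qed.

Lemma theta_mul (K : fieldType) n m (x y : HSP K) w :
  homogeneous n x -> homogeneous m y ->
  theta w (x * y) =
    (perm_eq w (iota 0 (n + m)))%:R * (theta (low n w) x * theta (high n w) y).
Proof.
move=> hx hy; rewrite malgME theta_sum [theta (low n w) x]thetaE.
rewrite mulr_suml mulr_sumr !big_seq; apply: eq_bigr => P /hx <-.
rewrite theta_sum [theta (high _ _) y]thetaE !mulr_sumr !big_seq.
apply: eq_bigr => Q /hy <-; rewrite malgUZ.
rewrite thetaZ thetaU; case: (boolP (perm_eq _ _)) => pw.
  by rewrite linext_mul // -mulnb natrM mul1r mulrACA.
by rewrite /linext sp_size_mul (negbTE pw) mulr0 mul0r.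
Qed.

Lemma HHOF_mul (K : fieldType) (x y : HSP K) : HHOF x -> HHOF y -> HHOF (x * y).
Proof.
move=> hx hy; rewrite malgME big_seq; apply: in_span_sum => P /hx hP.
rewrite big_seq; apply: in_span_sum => Q /hy hQ.
by apply: in_spanU; apply: is_hof_mul.
Qed.

Lemma HHOF_theta_inj (K : fieldType) (x y : HSP K) : HHOF x -> HHOF y ->
  (forall w, theta w x = theta w y) -> x = y.
Proof.
move=> hx hy h; apply/eqP; rewrite -subr_eq0; apply/eqP/HHOF_theta0.
  exact: in_spanB.
by move=> w; rewrite thetaB h subrr.
Qed.

Lemma Upsilon_sum (K : fieldType) I (r : seq I) (Q : pred I) (F : I -> HSP K) :
  Upsilon (\sum_(i <- r | Q i) F i) = \sum_(i <- r | Q i) Upsilon (F i).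
Proof. exact: lin_ext_sum. Qed.

Lemma HSP_scalerAr (K : fieldType) a (x y : HSP K) : x * (a *: y) = a *: (x * y).
Proof.
rewrite (malgMEw (fsubset_refl (msupp x)) (msuppZ_le a y)) malgME scaler_sumr.
apply: eq_bigr => P _; rewrite scaler_sumr; apply: eq_bigr => Q _.
by rewrite mcoeffZ malgUZ [in RHS]malgUZ scalerA mulrCA.
Qed.

Lemma UpsilonP (K : fieldType) (a : K) (x y : HSP K) :
  Upsilon (a *: x + y) = a *: Upsilon x + Upsilon y.
Proof. exact: lin_ext_is_linear. Qed.

Lemma Upsilon0 (K : fieldType) : Upsilon (0 : HSP K) = 0.
Proof. exact: (linear0 (lin_ext _)). Qed.

(** Both sides are combinations of heap-ordered forests, and [theta_mul] computes
    their [theta] from that of the arguments. *)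
Lemma Upsilon_mul (K : fieldType) (x y : HSP K) :
  Upsilon (x * y) = Upsilon x * Upsilon y.
Proof.
have basis (P Q : sposet) : Upsilon ((<< P >> : HSP K) * << Q >>) =
    Upsilon << P >> * Upsilon << Q >>.
  have U R : homogeneous (sp_size R) (<< R >> : HSP K) by apply: in_spanU.
  apply: HHOF_theta_inj => [||w].
  - exact: Upsilon_HHOF.
  - by apply: HHOF_mul; apply: Upsilon_HHOF.
  rewrite theta_Upsilon (theta_mul _ (U P) (U Q)).
  rewrite (theta_mul _ (Upsilon_homogeneous (U P)) (Upsilon_homogeneous (U Q))).
  by rewrite !theta_Upsilon.
have left P z : Upsilon ((<< P >> : HSP K) * z) = Upsilon << P >> * Upsilon z.
  elim/malg_ind: z => [|a Q z IH]; first by rewrite mulr0 Upsilon0 mulr0.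
  by rewrite mulrDr HSP_scalerAr UpsilonP basis IH UpsilonP mulrDr HSP_scalerAr.
elim/malg_ind: x => [|a P x IH]; first by rewrite mul0r Upsilon0 mul0r.
by rewrite mulrDl -scalerAl UpsilonP left IH UpsilonP mulrDl scalerAl.
Qed.

(** * The coproduct *)

Definition letters n (A : {set 'I_n}) : seq nat := [seq val i | i <- enum A].

Lemma size_letters n (A : {set 'I_n}) : size (letters A) = #|A|.
Proof. by rewrite size_map -cardE. Qed.

Lemma mem_letters n (A : {set 'I_n}) (i : 'I_n) : (val i \in letters A) = (i \in A).
Proof. by rewrite mem_map ?mem_enum //; apply: val_inj. Qed.

Lemma uniq_letters n (A : {set 'I_n}) : uniq (letters A).
Proof. by rewrite map_inj_uniq ?enum_uniq //; apply: val_inj. Qed.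

Lemma lettersP n (A : {set 'I_n}) k :
  reflect (exists2 i, i \in A & k = val i) (k \in letters A).
Proof.
apply: (iffP mapP) => -[i iA ->]; exists i => //; first by rewrite mem_enum in iA.
by rewrite mem_enum.
Qed.

(** Both sequences are the increasing enumeration of A. *)
Lemma letters_le2_enum (P : sposet) (A : {set (P : dposet)}) :
  [seq val (val z) | z <- le2_enum (drestr A)] = letters A.
Proof.
apply: (sorted_eq leq_trans anti_leq).
- rewrite sorted_map; apply: sort_sorted => x y; exact: leq_total.
- rewrite /letters sorted_map {1}/enum_mem; apply: sorted_filter.
    by move=> y x z /=; apply: leq_trans.
  by rewrite -enumT -sorted_map val_enum_ord iota_sorted.
apply: uniq_perm.
- rewrite map_inj_uniq; last by move=> x y /val_inj /val_inj.
  by rewrite sort_uniq enum_uniq.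
- exact: uniq_letters.
move=> k; apply/mapP/lettersP => [[z _ ->]|[i iA ->]].
  by exists (val z) => //; apply: valP.
by exists (exist _ i iA) => //; rewrite mem_sort mem_enum.
Qed.

Lemma nat_le1_std_drestr (P : sposet) (A : {set (P : dposet)}) a b :
  (a < #|A|)%N -> (b < #|A|)%N ->
  nat_le1 (std (drestr A)) a b =
    nat_le1 P (nth 0%N (letters A) a) (nth 0%N (letters A) b).
Proof.
have nthE (i : 'I_#|drestr A|) :
    val (val (tnth (le2_enum (drestr A)) i)) = nth 0%N (letters A) i.
  rewrite -letters_le2_enum (nth_map (tnth (le2_enum (drestr A)) i)) -?tnth_nth //.
  by rewrite size_tuple.
rewrite -(card_sig (mem A)) => aA bA.
rewrite (@nat_le1_ord (std (drestr A)) (Ordinal aA) (Ordinal bA)) inE /=.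
by rewrite -nat_le1_ord !nthE.
Qed.

Lemma size_std_drestr (P : sposet) (A : {set (P : dposet)}) :
  sp_size (std (drestr A)) = #|A|.
Proof. exact: card_sig. Qed.

(** Relabelling u by the complement of A and v by A inverts the cutting of a word into
    a prefix and a suffix followed by standardization. *)
Definition glue n (A : {set 'I_n}) (u v : seq nat) : seq nat :=
  map (nth 0%N (letters (~: A))) u ++ map (nth 0%N (letters A)) v.

Lemma perm_map_letters n (A : {set 'I_n}) u : perm_eq u (iota 0 #|A|) ->
  perm_eq (map (nth 0%N (letters A)) u) (letters A).
Proof.
move/(perm_map (nth 0%N (letters A))) => h; apply: perm_trans h _.
by rewrite -size_letters map_nth_iota0 ?take_size.
Qed.

Lemma perm_glue n (A : {set 'I_n}) u v :
  perm_eq u (iota 0 #|~: A|) -> perm_eq v (iota 0 #|A|) ->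
  perm_eq (glue A u v) (iota 0 n).
Proof.
move=> /perm_map_letters pu /perm_map_letters pv.
apply: perm_trans (perm_cat pu pv) _; apply: uniq_perm; rewrite ?iota_uniq //.
  rewrite cat_uniq !uniq_letters andbT /=; apply/hasPn => k /lettersP[i iA ->].
  by rewrite /= mem_letters inE iA.
move=> k; rewrite mem_cat mem_iota add0n /=; apply/orP/idP.
  by case=> /lettersP[i _ ->]; apply: ltn_ord.
move=> kn.
rewrite -[k]/(val (Ordinal kn)) !mem_letters inE.
by case: (_ \in A); [right|left].
Qed.

(** The condition between a letter of the prefix and a letter of the suffix says that
    no element of A is below an element outside A. *)
Lemma linext_glue (P : sposet) (A : {set (P : dposet)}) u v :
  perm_eq u (iota 0 #|~: A|) -> perm_eq v (iota 0 #|A|) ->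
  linext P (glue A u v) =
    upper_set A && (linext (std (drestr (~: A))) u && linext (std (drestr A)) v).
Proof.
move=> pu pv; rewrite /linext !size_std_drestr pu pv (perm_glue pu pv) /=.
have mono (B : {set (P : dposet)}) t : perm_eq t (iota 0 #|B|) ->
    pairwise (fun a b => ~~ nat_le1 P b a) (map (nth 0%N (letters B)) t) =
    pairwise (fun a b => ~~ nat_le1 (std (drestr B)) b a) t.
  move=> pt; rewrite pairwise_map; apply: (eq_in_pairwise (P := gtn #|B|)).
    by move=> a b; rewrite -!topredE /= => aB bB; rewrite nat_le1_std_drestr.
  by apply/allP => k; rewrite (perm_iota_mem pt).
rewrite /glue pairwise_cat !mono //; congr (_ && _).
apply/allrelP/forallP => [h x|h a b].
  apply/forallP => y; apply/implyP => /andP[xA xy].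
  apply: contraT => nyA; have := h (val y) (val x).
  rewrite (perm_mem (perm_map_letters pu)) (perm_mem (perm_map_letters pv)).
  by rewrite !mem_letters inE nyA xA nat_le1_ord => /(_ isT isT) /negP.
rewrite (perm_mem (perm_map_letters pu)) (perm_mem (perm_map_letters pv)).
move=> /lettersP[y yA ->] /lettersP[x xA ->]; apply/negP; rewrite nat_le1_ord => xy.
have /forallP/(_ y)/implyP := h x; rewrite xA => /(_ xy) yA'.
by rewrite inE yA' in yA.
Qed.

Section Theta2.
Context (K : fieldType).

(** The coordinates of Theta tensor Theta. *)
Definition theta2 (u v : seq nat) (z : HSP2 K) : K :=
  lin_ext (fun p => (linext p.1 u && linext p.2 v)%:R : K^o) z.

Lemma theta2U u v p : theta2 u v << p >> = (linext p.1 u && linext p.2 v)%:R.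
Proof. exact: (lin_extU (V := K^o)). Qed.

Lemma theta2E u v z :
  theta2 u v z = \sum_(p <- msupp z) z@_p * (linext p.1 u && linext p.2 v)%:R.
Proof. by []. Qed.

Lemma theta2B u v z z' : theta2 u v (z - z') = theta2 u v z - theta2 u v z'.
Proof. exact: (linearB (lin_ext (V := K^o) _)). Qed.

Lemma theta2_sum u v I (r : seq I) (Q : pred I) (F : I -> HSP2 K) :
  theta2 u v (\sum_(i <- r | Q i) F i) = \sum_(i <- r | Q i) theta2 u v (F i).
Proof. exact: (lin_ext_sum (V := K^o)). Qed.

Lemma theta2Z u v a z : theta2 u v (a *: z) = a * theta2 u v z.
Proof. exact: (linearZ_LR (lin_ext (V := K^o) _)). Qed.

Lemma theta2_tensor u v (x y : HSP K) : theta2 u v (tensor x y) = theta u x * theta v y.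
Proof.
rewrite /tensor theta2_sum !thetaE mulr_suml; apply: eq_bigr => P _.
rewrite theta2_sum mulr_sumr; apply: eq_bigr => Q _.
by rewrite malgUZ theta2Z theta2U -mulnb natrM mulrACA.
Qed.

Lemma theta2_coproductU u v (P : sposet) :
  theta2 u v (coproduct << P >>) =
  \sum_(A : {set 'I_(sp_size P)} |
        perm_eq u (iota 0 #|~: A|) && perm_eq v (iota 0 #|A|))
    theta (glue A u v) (<< P >> : HSP K).
Proof.
rewrite /coproduct lin_extU theta2_sum big_mkcond [RHS]big_mkcond.
apply: eq_bigr => /= A _; rewrite theta2U thetaU /=.
have [/andP[pu pv]|npuv] := boolP (perm_eq u _ && perm_eq v _).
  by rewrite linext_glue //; case: upper_set.
case: ifP => // _; rewrite /linext !size_std_drestr.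
by move: npuv; case: (perm_eq u _) => //=; case: (perm_eq v _) => //=; rewrite andbF.
Qed.

(** The right-hand side sees x only through [theta], and the index set only depends
    on the degree n; this is the deconcatenation coproduct of FQSym. *)
Lemma theta2_coproduct u v n (x : HSP K) : homogeneous n x ->
  theta2 u v (coproduct x) =
  \sum_(A : {set 'I_n} | perm_eq u (iota 0 #|~: A|) && perm_eq v (iota 0 #|A|))
    theta (glue A u v) x.
Proof.
move=> hx; rewrite {1}[x]malg_basisE /coproduct lin_ext_sum theta2_sum.
under [RHS]eq_bigr do rewrite thetaE.
rewrite [RHS]exchange_big /= !big_seq; apply: eq_bigr => P /hx <-.
rewrite linearZ theta2Z theta2_coproductU mulr_sumr.
by apply: eq_bigr => A _; rewrite thetaU.
Qed.

Definition hof_pair (p : sposet * sposet) : Prop := is_hof p.1 /\ is_hof p.2.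

(** Injectivity of a tensor square: [HHOF_theta0] is applied in the first variable
    with v fixed, then in the second one. *)
Lemma hof_pair_theta2_0 (z : HSP2 K) :
  in_span hof_pair z -> (forall u v, theta2 u v z = 0) -> z = 0.
Proof.
move=> hz h.
have x0 v : \sum_(p <- msupp z) (z@_p * (linext p.2 v)%:R) *: << p.1 >> = 0 :> HSP K.
  apply: HHOF_theta0 => [|u].
    rewrite big_seq; apply: in_span_sum => p /hz[h1 _].
    by apply: in_spanZ; apply: in_spanU.
  rewrite -[RHS](h u v) theta_sum theta2E; apply: eq_bigr => p _.
  by rewrite thetaZ thetaU -mulnb natrM -mulrA [_%:R * _]mulrC.
have y0 P : \sum_(p <- msupp z | p.1 == P) z@_p *: << p.2 >> = 0 :> HSP K.
  apply: HHOF_theta0 => [|v].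
    rewrite big_seq_cond; apply: in_span_sum => p /andP[/hz[_ h2] _].
    by apply: in_spanZ; apply: in_spanU.
  transitivity ((0 : HSP K)@_P); last exact: mcoeff0.
  rewrite -[in RHS](x0 v) theta_sum raddf_sum big_mkcond /=.
  apply: eq_bigr => p _; rewrite mcoeffZ mcoeffU1 thetaZ thetaU.
  by case: eqP; rewrite ?mulr1 ?mulr0.
apply/malgP => -[P Q]; rewrite mcoeff0.
have := congr1 (fun x => x@_Q) (y0 P); rewrite /= mcoeff0 raddf_sum /= => <-.
have [pz|npz] := boolP ((P, Q) \in msupp z); last first.
  rewrite (mcoeff_outdom npz) big1_seq // => -[P' Q'] /andP[/eqP /= -> pz].
  rewrite mcoeffZ mcoeffU1; case: eqP => [e|_]; last by rewrite mulr0.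
  by rewrite -e pz in npz.
rewrite big_mkcond (big_rem (P, Q)) //= eqxx mcoeffZ mcoeffU1 eqxx mulr1.
rewrite big1_seq ?addr0 // => -[P' Q'] /=; rewrite mem_rem_uniq ?fset_uniq // inE.
case/andP=> npq _; case: eqP => // eP; rewrite mcoeffZ mcoeffU1.
case: eqP => [eQ|]; last by rewrite mulr0.
by rewrite eP eQ eqxx in npq.
Qed.

Lemma hof_pair_theta2_inj (z z' : HSP2 K) :
  in_span hof_pair z -> in_span hof_pair z' ->
  (forall u v, theta2 u v z = theta2 u v z') -> z = z'.
Proof.
move=> hz hz' h; apply/eqP; rewrite -subr_eq0; apply/eqP/hof_pair_theta2_0.
  exact: in_spanB.
by move=> u v; rewrite theta2B h subrr.
Qed.

Lemma coproduct_hof (x : HSP K) : HHOF x -> in_span hof_pair (coproduct x).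
Proof.
apply: in_span_lin_ext => P hP; apply: in_span_sum => A _; apply: in_spanU.
by split; apply: is_hof_std; by [apply: special_drestr | apply: is_hof_drestr].
Qed.

Lemma tensor_hof (x y : HSP K) : HHOF x -> HHOF y -> in_span hof_pair (tensor x y).
Proof.
move=> hx hy; rewrite /tensor big_seq; apply: in_span_sum => P /hx hP.
rewrite big_seq; apply: in_span_sum => Q /hy hQ; exact: in_spanU.
Qed.

Lemma theta2_tensor_Upsilon u v (z : HSP2 K) :
  theta2 u v (tensor_map (@Upsilon K) (@Upsilon K) z) = theta2 u v z.
Proof.
rewrite {2}[z]malg_basisE /tensor_map {1}/lin_ext !theta2_sum; apply: eq_bigr => p _.
by rewrite !theta2Z theta2_tensor !theta_Upsilon !thetaU theta2U -natrM mulnb.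
Qed.

Lemma coproductP a (x y : HSP K) :
  coproduct (a *: x + y) = a *: coproduct x + coproduct y.
Proof. exact: lin_ext_is_linear. Qed.

Lemma tensor_mapP (f g : HSP K -> HSP K) a (x y : HSP2 K) :
  tensor_map f g (a *: x + y) = a *: tensor_map f g x + tensor_map f g y.
Proof. exact: lin_ext_is_linear. Qed.

Lemma Upsilon_coproduct (x : HSP K) :
  coproduct (Upsilon x) = tensor_map (@Upsilon K) (@Upsilon K) (coproduct x).
Proof.
have basis (P : sposet) : coproduct (Upsilon (<< P >> : HSP K)) =
    tensor_map (@Upsilon K) (@Upsilon K) (coproduct << P >>).
  have hP : homogeneous (sp_size P) (<< P >> : HSP K) by apply: in_spanU.
  apply: hof_pair_theta2_inj => [||u v].
  - exact/coproduct_hof/Upsilon_HHOF.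
  - apply: (in_span_lin_ext (B := fun=> True)) => // p _.
    by apply: tensor_hof; apply: Upsilon_HHOF.
  rewrite theta2_tensor_Upsilon (theta2_coproduct _ _ (Upsilon_homogeneous hP)).
  by rewrite (theta2_coproduct _ _ hP); apply: eq_bigr => A _; rewrite theta_Upsilon.
elim/malg_ind: x => [|a P x IH].
  by rewrite Upsilon0 /coproduct /tensor_map !linear0.
by rewrite UpsilonP !coproductP tensor_mapP basis IH.
Qed.

End Theta2.

(** * The pairing *)

(** One-line notation. *)
Definition word n (s : 'S_n) : seq nat := [seq val (s i) | i <- enum 'I_n].

Lemma perm_word n (s : 'S_n) : perm_eq (word s) (iota 0 n).
Proof.
have inj : injective (fun i => val (s i)) by move=> i j /val_inj /perm_inj.
apply: uniq_perm; rewrite ?iota_uniq ?(map_inj_uniq inj) ?enum_uniq // => k.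
rewrite mem_iota add0n /=; apply/mapP/idP => [[i _ ->]|kn]; first exact: ltn_ord.
by exists (s^-1 (Ordinal kn))%g; rewrite ?mem_enum // permKV.
Qed.

Lemma index_word n (s : 'S_n) i : index (val (s i)) (word s) = i.
Proof.
have inj : injective (fun i => val (s i)) by move=> j k /val_inj /perm_inj.
by rewrite (index_map inj) index_enum_ord.
Qed.

Lemma index_wordV n (s : 'S_n) i : index (val i) (word s) = (s^-1)%g i.
Proof. by rewrite -{1}(permKV s i) index_word. Qed.

Lemma word_inj n : injective (@word n).
Proof.
move=> s t e; apply: invg_inj; apply/permP => i; apply: val_inj => /=.
by rewrite -!index_wordV e.
Qed.

Lemma word_surj n w : perm_eq w (iota 0 n) -> exists s : 'S_n, word s = w.
Proof.
move=> pw; have szw := perm_iota_size pw.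
have lt (i : 'I_n) : (nth 0 w i < n)%N by rewrite -(perm_iota_mem pw) mem_nth ?szw.
have inj : injective (fun i => Ordinal (lt i)).
  move=> i j /(congr1 val) /= /eqP.
  by rewrite nth_uniq ?szw ?(perm_iota_uniq pw) // => /eqP /val_inj.
exists (perm inj); rewrite -[RHS]take_size -(map_nth_iota0 0%N (leqnn _)) szw.
rewrite -val_enum_ord -map_comp /word; apply: eq_map => i /=.
by rewrite permE.
Qed.

(** The letter i has position t i in the word of t^-1, so the first condition on a
    picture t says that this word is a linear extension of P.  Exchanging t and
    t^-1, the second condition says the same of the word of t and Q. *)
Lemma card_pictures_eq n (r s : {set 'I_n * 'I_n}) p q
    (P := @SPoset n r p) (Q := @SPoset n s q) :
  #|pictures P Q| = (\sum_(t : 'S_n) (linext P (word (t^-1)%g) && linext Q (word t)))%N.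
Proof.
pose B := [set t : 'S_n | linext P (word (t^-1)%g) && linext Q (word t)].
have pvalE (t : 'S_n) i : pval t i = t i by rewrite -pvalE.
have inB t : (t \in B) = (pval t \in pictures P Q).
  rewrite !inE.
  have -> : injectiveb (pval t).
    by apply/injectiveP => i j; rewrite !pvalE; apply: perm_inj.
  have -> : [forall y, exists x, pval t x == y].
    by apply/forallP => y; apply/existsP; exists (t^-1 y)%g; rewrite pvalE permKV.
  rewrite /=; congr (_ && _).
    apply/(linextP (P := P) (perm_word _))/forallP => /= [h i|h i j ij].
      apply/forallP => j; apply/implyP => /h; rewrite !index_wordV invgK.
      by rewrite !pvalE.
    have /forallP/(_ j)/implyP/(_ ij) := h i.
    by rewrite !index_wordV invgK !pvalE.
  apply/(linextP (P := Q) (perm_word _))/forallP => /= [h i|h i j ij].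
    apply/forallP => j; apply/implyP; rewrite !pvalE => /h.
    by rewrite !index_word.
  have /forallP/(_ (t^-1 j)%g)/implyP := h (t^-1 i)%g.
  by rewrite !pvalE !permKV !index_wordV; apply.
transitivity #|B|; last first.
  by rewrite -sum1_card big_mkcond; apply: eq_bigr => t _; rewrite inE; case: (_ && _).
rewrite -(card_imset B (@val_inj _ _ _)); apply: eq_card => f.
apply/idP/imsetP => [fP|[t tB ->]]; last by rewrite -inB.
have injf : injectiveb f by have := fP; rewrite inE => /and4P[].
exists (Perm injf) => //; by rewrite inB.
Qed.

Lemma pictures_size (P Q : sposet) : sp_size P <> sp_size Q -> #|pictures P Q| = 0%N.
Proof.
move=> ne; apply: eq_card0 => f; apply/negbTE/negP.
rewrite inE => /and4P[/injectiveP inj sur _ _].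
apply: ne; have := card_imset (mem P) inj.
have -> : f @: P = [set: Q].
  apply/setP => y; rewrite !inE; apply/imsetP.
  by have /existsP[x /eqP <-] := forallP sur y; exists x.
by rewrite cardsT !card_ord => ->.
Qed.

Section Pairing.
Context (K : fieldType).
Implicit Types x y : HSP K.

(** The sum over all degrees n < N has only one possibly nonzero term; it avoids
    splitting elements into homogeneous components. *)
Lemma card_pictures N (P Q : sposet) : (sp_size P < N)%N ->
  #|pictures P Q|%:R =
  \sum_(n < N) \sum_(t : 'S_n)
    (linext P (word (t^-1)%g))%:R * (linext Q (word t))%:R :> K.
Proof.
move=> PN.
have wsz (R : sposet) n (t : 'S_n) : sp_size R <> n -> linext R (word t) = false.
  move=> ne; apply/negP => /andP[/perm_iota_size e _]; apply: ne.
  by rewrite -e (perm_iota_size (perm_word t)).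
rewrite (bigD1 (Ordinal PN)) //= [X in _ + X]big1 ?addr0 => [|n nP]; last first.
  apply: big1 => t _; rewrite wsz ?mul0r // => e.
  by rewrite -(inj_eq val_inj) /= e eqxx in nP.
have [e|ne] := eqVneq (sp_size P) (sp_size Q); last first.
  rewrite pictures_size; last exact/eqP.
  by rewrite big1 // => t _; rewrite [linext Q _]wsz ?mulr0 //; apply/eqP; rewrite eq_sym.
case: P Q PN e => n r p [m s q] /= _ e; case: m / e s q => s q.
rewrite (card_pictures_eq p q) natr_sum; apply: eq_bigr => t _.
by rewrite -natrM mulnb.
Qed.

Lemma pairing_theta N x y : in_span (fun P => (sp_size P < N)%N) x ->
  pairing x y =
  \sum_(n < N) \sum_(t : 'S_n) theta (word (t^-1)%g) x * theta (word t) y.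
Proof.
move=> hx; rewrite /pairing.
transitivity (\sum_(P <- msupp x) \sum_(Q <- msupp y) \sum_(n < N) \sum_(t : 'S_n)
    (x@_P * (linext P (word (t^-1)%g))%:R) * (y@_Q * (linext Q (word t))%:R)).
  rewrite !big_seq; apply: eq_bigr => P /hx PN; apply: eq_bigr => Q _.
  rewrite (card_pictures Q PN) mulr_sumr; apply: eq_bigr => n _.
  by rewrite mulr_sumr; apply: eq_bigr => t _; rewrite mulrACA.
under eq_bigr do rewrite exchange_big.
rewrite exchange_big; apply: eq_bigr => n _.
under eq_bigr do rewrite exchange_big.
rewrite exchange_big; apply: eq_bigr => t _.
by rewrite !thetaE big_distrlr.
Qed.

Lemma size_bound x : exists N, in_span (fun P => (sp_size P < N)%N) x.
Proof.
exists (\max_(P <- msupp x) (sp_size P).+1)%N => P Px.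
exact: (@leq_bigmax_seq _ _ xpredT (fun P => (sp_size P).+1)).
Qed.

Lemma Upsilon_size_bound N x : in_span (fun P => (sp_size P < N)%N) x ->
  in_span (fun P => (sp_size P < N)%N) (Upsilon x).
Proof.
by apply: in_span_lin_ext => P PN Q /Upsilon_basis_homogeneous ->.
Qed.

Lemma Upsilon_pairing x y : pairing (Upsilon x) (Upsilon y) = pairing x y.
Proof.
have [N hx] := size_bound x.
rewrite (pairing_theta _ hx) (pairing_theta _ (Upsilon_size_bound hx)).
by do 2!apply: eq_bigr => ? _; rewrite !theta_Upsilon.
Qed.

(** Words of different degrees have different lengths, so only the permutation s
    itself contributes. *)
Lemma sum_word_pick N n (s : 'S_n) (F : forall m, 'S_m -> K) : (n < N)%N ->
  \sum_(m < N) \sum_(t : 'S_m) F m t * (word t == word s)%:R = F n s.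
Proof.
move=> nN.
rewrite (bigD1 (Ordinal nN)) //= [X in _ + X]big1 ?addr0 => [|m nm]; last first.
  apply: big1 => t _; case: eqP; rewrite ?mulr0 // => /(congr1 size).
  rewrite !(perm_iota_size (perm_word _)) => e.
  by rewrite -(inj_eq val_inj) /= e eqxx in nm.
rewrite (bigD1 s) //= eqxx mulr1 big1 ?addr0 // => t.
by rewrite (inj_eq (@word_inj n)) => /negbTE ->; rewrite mulr0.
Qed.

Lemma theta_not_perm w x : ~~ perm_eq w (iota 0 (size w)) -> theta w x = 0.
Proof.
move=> npw; rewrite thetaE big1 // => P _; rewrite /linext.
case: (boolP (perm_eq _ _)) => [pw|_]; last by rewrite mulr0.
by rewrite (perm_iota_size pw) pw in npw.
Qed.

(** When [theta w y] is the indicator of one permutation, the pairing with the image of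
    y under Upsilon extracts a single coordinate [theta]. *)
Lemma pairing_nondegenerate : nondegenerate_on (@HHOF K) (@pairing K).
Proof.
split=> x hx h; apply: HHOF_theta0 => // w;
  have [pw|] := boolP (perm_eq w (iota 0 (size w))); try exact: theta_not_perm;
  move: (size w) pw => n pw; have [s <-] := word_surj pw.
- have [N hN] := size_bound x.
  have [y [_ _ ty]] := theta_delta K (perm_word (s^-1)%g).
  rewrite -[RHS](h (Upsilon y)); last exact: Upsilon_HHOF.
  rewrite (@pairing_theta (N + n.+1)%N); last first.
    by move=> P /hN /= lt; apply: leq_trans lt (leq_addr _ _).
  under eq_bigr do under eq_bigr do rewrite theta_Upsilon ty.
  rewrite (sum_word_pick (s^-1)%g (fun m t => theta (word (t^-1)%g) x)) ?invgK //.
  by rewrite addnS ltnS leq_addl.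
- have [y [_ hy ty]] := theta_delta K (perm_word (s^-1)%g).
  rewrite -[RHS](h (Upsilon y)); last exact: Upsilon_HHOF.
  rewrite (@pairing_theta n.+1); last first.
    by apply: Upsilon_size_bound => P /hy ->.
  have sumV m (F : 'S_m -> K) : \sum_t F t = \sum_(t : 'S_m) F (t^-1)%g.
    by apply: (reindex_inj (h := fun t : 'S_m => (t^-1)%g)); apply: invg_inj.
  under eq_bigr do rewrite sumV.
  under eq_bigr do under eq_bigr do rewrite invgK theta_Upsilon ty mulrC.
  by rewrite (sum_word_pick (s^-1)%g (fun m t => theta (word (t^-1)%g) x)) ?invgK.
Qed.

(** * The antipode *)

(** Uniqueness of the representative with a given [theta]. *)
Lemma Upsilon_hof (P : sposet) : is_hof P -> Upsilon (<< P >> : HSP K) = << P >>.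
Proof.
move=> hP; apply: HHOF_theta_inj; [exact: Upsilon_HHOF | exact: in_spanU | ].
exact: theta_Upsilon.
Qed.

Lemma Upsilon1 : Upsilon (1 : HSP K) = 1.
Proof.
by apply: (@Upsilon_hof sp0); apply/andP; split; apply/forallP => -[].
Qed.

Lemma antipodeP a x y : antipode (a *: x + y) = a *: antipode x + antipode y.
Proof. exact: lin_ext_is_linear. Qed.

Lemma antipode1 : antipode (1 : HSP K) = 1.
Proof. by rewrite /antipode [LHS]lin_extU /= eqxx. Qed.

(** Multiplication after antipode tensor identity. *)
Definition convolve (z : HSP2 K) : HSP K :=
  lin_ext (fun p => antipode << p.1 >> * << p.2 >>) z.

Lemma convolve_tensor x y : convolve (tensor x y) = antipode x * y.
Proof.
rewrite /convolve /tensor lin_ext_sum [antipode x]/lin_ext mulr_suml.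
apply: eq_bigr => P _; rewrite lin_ext_sum [in RHS](malg_basisE y) mulr_sumr.
apply: eq_bigr => Q _; rewrite lin_extUZ /= -scalerAl HSP_scalerAr scalerA.
by rewrite /antipode lin_extU.
Qed.

Lemma convolve_coproduct n x : (0 < n)%N -> homogeneous n x -> convolve (coproduct x) = 0.
Proof.
move=> n0 hx; rewrite [x]malg_basisE /coproduct lin_ext_sum /convolve lin_ext_sum.
rewrite big_seq big1 // => P /hx eP; rewrite !linearZ /= lin_extU lin_ext_sum.
under eq_bigr do rewrite lin_extU /=.
rewrite antipodeE ?scaler0 //.
by apply: contraTneq n0 => e; rewrite -eP e.
Qed.

Lemma drestr_set0 (P : sposet) : std (drestr (set0 : {set (P : dposet)})) = sp0.
Proof. by apply: sp_size0; rewrite size_std_drestr cards0. Qed.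

Lemma drestr_setC0 (P : sposet) : std (drestr (~: (set0 : {set (P : dposet)}))) = P.
Proof.
rewrite -[RHS]std_sposet; apply: diso_std_eq; first exact: special_drestr.
exists val; split=> //; apply: inj_card_bij; first exact: val_inj.
by rewrite card_sig setC0 cardsT.
Qed.

(** Upsilon applied to the recursion for the antipode of P, and the recursion for the
    antipode of Upsilon P, have the same terms for nonempty upper sets by induction,
    hence also the same term for the empty one. *)
Lemma Upsilon_antipodeU (P : sposet) :
  Upsilon (antipode (<< P >> : HSP K)) = antipode (Upsilon << P >>).
Proof.
have [m] := ubnP (sp_size P); elim: m P => // m IH P lt.
have [->|nP] := eqVneq P sp0.
  by rewrite -[<< sp0 >>]/(1 : HSP K) antipode1 Upsilon1 antipode1.
have P0 : (0 < sp_size P)%N.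
  by rewrite lt0n; apply: contra_neqN nP => /eqP /sp_size0.
have hP : homogeneous (sp_size P) (<< P >> : HSP K) by apply: in_spanU.
have up0 : upper_set (set0 : {set (P : dposet)}).
  by apply/forallP => a; apply/forallP => b; rewrite inE.
have := congr1 (@Upsilon K) (antipodeE K nP); rewrite Upsilon0 Upsilon_sum.
rewrite (eq_bigr _ (fun I _ => Upsilon_mul _ _)).
rewrite (bigD1 set0) //= drestr_set0 drestr_setC0 => e1.
have := convolve_coproduct P0 (Upsilon_homogeneous hP).
rewrite Upsilon_coproduct {1}/coproduct lin_extU /tensor_map lin_ext_sum.
rewrite /convolve lin_ext_sum -/convolve.
under eq_bigr do rewrite lin_extU /= -/(convolve _) convolve_tensor.
rewrite (bigD1 set0) //= drestr_set0 drestr_setC0 => e2.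
have := etrans e1 (esym e2); rewrite -[<< sp0 >>]/(1 : HSP K) Upsilon1 !mulr1.
rewrite [X in _ + X = _](eq_bigr (fun I : {set (P : dposet)} =>
   antipode (Upsilon << std (drestr (~: I)) >>) * Upsilon << std (drestr I) >>)).
  by move/addIr.
move=> I /andP[_ nI]; rewrite IH // size_std_drestr.
apply: leq_trans (_ : sp_size P <= m)%N; last by [].
by rewrite -[ltnRHS]card_ord -(cardsC I) -[ltnLHS]add0n ltn_add2r card_gt0.
Qed.

Lemma Upsilon_antipode x : Upsilon (antipode x) = antipode (Upsilon x).
Proof.
elim/malg_ind: x => [|a P x IH]; first by rewrite Upsilon0 /antipode linear0 Upsilon0.
by rewrite antipodeP !UpsilonP antipodeP Upsilon_antipodeU IH.
Qed.

(** * The isomorphism *)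

(** Upsilon preserves the degree, and the counit is the coordinate in degree 0. *)
Lemma Upsilon_counit x : counit (Upsilon x) = counit x.
Proof.
rewrite /counit; elim/malg_ind: x => [|a P x IH]; first by rewrite Upsilon0.
rewrite UpsilonP !mcoeffD !mcoeffZ IH; congr (_ * _ + _).
have [->|nP] := eqVneq P sp0.
  by rewrite -[<< sp0 >>]/(1 : HSP K) Upsilon1.
rewrite mcoeffU1 (negbTE nP); apply: mcoeff_outdom; apply: contra_neqN nP.
have hP : homogeneous (sp_size P) (<< P >> : HSP K) by apply: in_spanU.
by move/(Upsilon_homogeneous hP) => e; apply: sp_size0; rewrite -e.
Qed.

(** Expansion on the dual basis. *)
Lemma HSPP_theta_onto x : exists2 y, HSPP y & forall w, theta w y = theta w x.
Proof.
have basis P : exists2 y : HSP K, HSPP y & forall w, theta w y = (linext P w)%:R.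
  have : forall v, v \in [seq v <- permutations (iota 0 (sp_size P)) | linext P v] ->
      perm_eq v (iota 0 (sp_size P)).
    by move=> v; rewrite mem_filter mem_permutations => /andP[].
  have : forall w, (linext P w) =
      (w \in [seq v <- permutations (iota 0 (sp_size P)) | linext P v]).
    by move=> w; rewrite mem_filter mem_permutations andb_idr // => /andP[].
  have : uniq [seq v <- permutations (iota 0 (sp_size P)) | linext P v].
    by rewrite filter_uniq ?permutations_uniq.
  move: [seq _ <- _ | _] => r ur lr pr.
  suff [y hy ty] : exists2 y : HSP K, HSPP y & forall w, theta w y = (w \in r)%:R.
    by exists y => // w; rewrite ty lr.
  elim: r ur pr {lr} => [|v r IH] /=.
    by exists 0 => [|w]; [exact: in_span0|rewrite thetaE msupp0 big_seq_fset0].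
  case/andP=> vr ur pr; have [//|v' h|y hy ty] := IH.
    by apply: pr; rewrite inE h orbT.
  have [z [hz _ tz]] := theta_delta K (pr v (mem_head v r)).
  exists (z + y) => [|w]; first exact: in_spanD.
  rewrite thetaD tz ty inE; case: eqP => [->|_]; last by rewrite add0r.
  by rewrite (negbTE vr) addr0.
elim/malg_ind: x => [|a P x [y hy ty]]; first by exists 0 => //; apply: in_span0.
have [z hz tz] := basis P; exists (a *: z + y) => [|w].
  by apply: in_spanD => //; apply: in_spanZ.
by rewrite !thetaD !thetaZ ty tz thetaU.
Qed.

End Pairing.

Theorem corollary4p9 (K : fieldType) :
  (graded_hopf_iso (@HSPP K) (@HHOF K) (@Upsilon K) /\
   (forall x y : HSP K, HSPP x -> HSPP y ->
      pairing (Upsilon x) (Upsilon y) = pairing x y)) /\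
  nondegenerate_on (@HHOF K) (@pairing K).
Proof.
split; last exact: pairing_nondegenerate.
split; last by move=> x y _ _; apply: Upsilon_pairing.
split.
- by move=> a x y _ _; apply: UpsilonP.
- by move=> x _; apply: Upsilon_HHOF.
- move=> x y hx hy e; apply/eqP; rewrite -subr_eq0; apply/eqP/HSPP_theta0.
    exact: in_spanB.
  by move=> w; rewrite thetaB -(theta_Upsilon x) -(theta_Upsilon y) e subrr.
- move=> y hy; have [x hx tx] := HSPP_theta_onto y; exists x => //.
  apply: HHOF_theta_inj => // [|w]; first exact: Upsilon_HHOF.
  by rewrite theta_Upsilon.
- by move=> n x _; apply: Upsilon_homogeneous.
- exact: Upsilon1.
- by move=> x y _ _; apply: Upsilon_mul.
- by move=> x _; apply: Upsilon_counit.
- by move=> x _; apply: Upsilon_coproduct.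
- by move=> x _; apply: Upsilon_antipode.
Qed.
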